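(* Let $R$ be a commutative artinian ring, $\Lambda$ an Artin $R$-algebra, $d\geq 1$ an integer, and $\mathcal{M}$ a $d$-cluster-tilting subcategory of $\operatorname{mod}\Lambda$. Then there is a bifunctorial isomorphism between the functor $$\operatorname{K}d\text{-}\operatorname{Ex}(\mathcal{M})^{\mathrm{op}}\times\underline{\mathcal{M}}\to\operatorname{mod}R,\qquad (\delta,X)\mapsto D\delta^*(X)$$ and the functor $$\operatorname{K}d\text{-}\operatorname{Ex}(\mathcal{M})^{\mathrm{op}}\times\underline{\mathcal{M}}\to\operatorname{mod}R,\qquad (\delta,X)\mapsto \delta_*(\tau_dX).$$
   Context: $\operatorname{mod}\Lambda$ is the category of finite length (equivalently, finitely presented) right $\Lambda$-modules. All subcategories of $\operatorname{mod}\Lambda$ are full and closed under (finite) direct sums and direct summands. $D=\operatorname{Hom}_R(-,I)$, where $I$ is the injective envelope of the direct sum of representatives of the isomorphism classes of simple $R$-modules; it gives dualities $\operatorname{mod}\Lambda\to\operatorname{mod}\Lambda^{\mathrm{op}}$ and $\operatorname{mod}R\to\operatorname{mod}R$. A functorially finite (i.e. contravariantly and covariantly finite) subcategory $\mathcal{M}$ of $\operatorname{mod}\Lambda$ is $d$-cluster-tilting if $$\mathcal{M}=\{X\mid \operatorname{Ext}^k_\Lambda(X,\mathcal{M})=0\ \forall k\in\{1,\dots,d-1\}\}=\{Y\mid \operatorname{Ext}^k_\Lambda(\mathcal{M},Y)=0\ \forall k\in\{1,\dots,d-1\}\}$$ with $X,Y$ ranging over $\operatorname{mod}\Lambda$.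 A $d$-exact sequence in $\mathcal{M}$ is a complex $\delta: L\to M^1\to\cdots\to M^d\to N$ in $\mathcal{M}$ such that for every $X\in\mathcal{M}$ both induced sequences $0\to\operatorname{Hom}_\Lambda(X,L)\to\operatorname{Hom}_\Lambda(X,M^1)\to\cdots\to\operatorname{Hom}_\Lambda(X,M^d)\to\operatorname{Hom}_\Lambda(X,N)$ and $0\to\operatorname{Hom}_\Lambda(N,X)\to\operatorname{Hom}_\Lambda(M^d,X)\to\cdots\to\operatorname{Hom}_\Lambda(M^1,X)\to\operatorname{Hom}_\Lambda(L,X)$ are exact. The contravariant defect of $\delta$ is $\delta^*=\operatorname{Coker}(\operatorname{Hom}_\Lambda(-,M^d)\to\operatorname{Hom}_\Lambda(-,N))$ and the covariant defect is $\delta_*=\operatorname{Coker}(\operatorname{Hom}_\Lambda(M^1,-)\to\operatorname{Hom}_\Lambda(L,-))$. $\operatorname{K}d\text{-}\operatorname{Ex}(\mathcal{M})$ is the category whose objects are the $d$-exact sequences in $\mathcal{M}$ and whose morphisms are homotopy classes of morphisms of complexes. $\underline{\mathcal{M}}$ (resp. $\overline{\mathcal{M}}$) is the full subcategory of the projectively stable category $\underline{\operatorname{mod}}\Lambda$ (resp. injectively stable category $\overline{\operatorname{mod}}\Lambda$) given by the objects of $\mathcal{M}$. The assignments $\delta^*$ and $\delta_*$ depend functorially on $\delta$ (covariantly, resp. contravariantly) and on the argument; they are invariant under homotopy, and $\delta^*$ (resp. $\delta_*$) vanishes on projectives (resp. injectives). $\operatorname{Tr}_d=\operatorname{Tr}\Omega^{d-1}:\underline{\operatorname{mod}}\Lambda\to\underline{\operatorname{mod}}\Lambda^{\mathrm{op}}$,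 where $\operatorname{Tr}$ is the Auslander–Bridger transpose and $\Omega$ the syzygy functor, and $\tau_d=D\operatorname{Tr}_d:\underline{\operatorname{mod}}\Lambda\to\overline{\operatorname{mod}}\Lambda$. *)

(* Defs.v *)
From HB Require Import structures.
From mathcomp Require Import all_boot all_order all_algebra.
From mathcomp Require Import boolp.

Set Implicit Arguments.
Unset Strict Implicit.
Unset Printing Implicit Defensive.

Import GRing.Theory.
Local Open Scope ring_scope.
Local Open Scope quotient_scope.

(* Hom-sets are setoids: the hom-set of the category is the quotient of
   [Mor X Y] by [meq].  Stable categories and homotopy categories are obtained
   by enlarging [meq]. *)

Record category := Category {
  Ob :> Type;
  Mor : Ob -> Ob -> Type;
  meq : forall X Y : Ob, Mor X Y -> Mor X Y -> Prop;
  idm : forall X : Ob, Mor X X;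
  comp : forall X Y Z : Ob, Mor Y Z -> Mor X Y -> Mor X Z;
  meq_refl : forall X Y (f : Mor X Y), meq f f;
  meq_sym : forall X Y (f g : Mor X Y), meq f g -> meq g f;
  meq_trans : forall X Y (f g h : Mor X Y), meq f g -> meq g h -> meq f h;
  comp_meq : forall X Y Z (g g' : Mor Y Z) (f f' : Mor X Y),
    meq g g' -> meq f f' -> meq (comp g f) (comp g' f');
  comp_idl : forall X Y (f : Mor X Y), meq (comp (idm Y) f) f;
  comp_idr : forall X Y (f : Mor X Y), meq (comp f (idm X)) f;
  compA : forall X Y Z W (h : Mor Z W) (g : Mor Y Z) (f : Mor X Y),
    meq (comp h (comp g f)) (comp (comp h g) f)
}.

Arguments Mor {c} X Y.
Arguments meq {c X Y} f g.
Arguments idm {c} X.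
Arguments comp {c X Y Z} g f.

Definition op (C : category) : category :=
  @Category C (fun X Y => @Mor C Y X) (fun X Y f g => meq f g) (fun X => idm X)
    (fun X Y Z g f => comp f g)
    (fun X Y f => meq_refl f)
    (fun X Y f g => @meq_sym C _ _ f g)
    (fun X Y f g h => @meq_trans C _ _ f g h)
    (fun X Y Z g g' f f' eg ef => comp_meq ef eg)
    (fun X Y f => comp_idr f)
    (fun X Y f => comp_idl f)
    (fun X Y Z W h g f => meq_sym (compA f g h)).

Section ProductCategory.
Variables C D : category.

Definition prodC : category.
Proof.
refine (@Category (C * D)%type
  (fun X Y => (@Mor C X.1 Y.1 * @Mor D X.2 Y.2)%type)
  (fun X Y f g => meq f.1 g.1 /\ meq f.2 g.2)
  (fun X => (idm X.1, idm X.2))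
  (fun X Y Z g f => (comp g.1 f.1, comp g.2 f.2)) _ _ _ _ _ _ _).
- by move=> X Y f; split; apply: meq_refl.
- by move=> X Y f g [e1 e2]; split; apply: meq_sym.
- move=> X Y f g h [e1 e2] [e1' e2'].
  by split; [apply: meq_trans e1 e1' | apply: meq_trans e2 e2'].
- by move=> X Y Z g g' f f' [eg1 eg2] [ef1 ef2]; split; apply: comp_meq.
- by move=> X Y f; split; apply: comp_idl.
- by move=> X Y f; split; apply: comp_idr.
- by move=> X Y Z W h g f; split; apply: compA.
Defined.

End ProductCategory.

Definition full_sub (C : category) (P : C -> Prop) : category :=
  @Category {X : C | P X} (fun X Y => @Mor C (sval X) (sval Y))
    (fun X Y f g => meq f g) (fun X => idm (sval X))
    (fun X Y Z g f => comp g f)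
    (fun X Y f => meq_refl f)
    (fun X Y f g => @meq_sym C _ _ f g)
    (fun X Y f g h => @meq_trans C _ _ f g h)
    (fun X Y Z g g' f f' => @comp_meq C _ _ _ g g' f f')
    (fun X Y f => comp_idl f)
    (fun X Y f => comp_idr f)
    (fun X Y Z W h g f => compA h g f).

(* The two assignments underlying a functor; [is_functor] says that they
   define one. *)
Record fdata (C D : category) := FData {
  fob :> C -> D;
  fmor : forall X Y : C, Mor X Y -> Mor (fob X) (fob Y)
}.

Record is_functor (C D : category) (F : fdata C D) : Prop := IsFunctor {
  fmor_meq : forall X Y (f g : @Mor C X Y), meq f g -> meq (fmor F f) (fmor F g);
  fmor_id : forall X : C, meq (fmor F (idm X)) (idm (F X));
  fmor_comp : forall (X Y Z : C) (g : Mor Y Z) (f : Mor X Y),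
    meq (fmor F (comp g f)) (comp (fmor F g) (fmor F f))
}.

Definition fid (C : category) : fdata C C := @FData C C id (fun _ _ f => f).

Definition fcomp (C D E : category) (G : fdata D E) (F : fdata C D) : fdata C E :=
  @FData C E (fun X => G (F X)) (fun _ _ f => fmor G (fmor F f)).

Definition fop (C D : category) (F : fdata C D) : fdata (op C) (op D) :=
  @FData (op C) (op D) F (fun X Y f => @fmor _ _ F Y X f).

Definition fprod (C C' D D' : category) (F : fdata C D) (F' : fdata C' D') :
    fdata (prodC C C') (prodC D D') :=
  @FData (prodC C C') (prodC D D') (fun X => (F X.1, F' X.2))
    (fun _ _ f => (fmor F f.1, fmor F' f.2)).

Definition fincl (C : category) (P : C -> Prop) : fdata (full_sub P) C :=
  @FData (full_sub P) C (fun X => sval X) (fun _ _ f => f).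

Definition fiter (C : category) (n : nat) (F : fdata C C) : fdata C C :=
  iter n (fcomp F) (fid C).

Definition is_iso (C : category) (X Y : C) (f : Mor X Y) : Prop :=
  exists g : Mor Y X, meq (comp g f) (idm X) /\ meq (comp f g) (idm Y).

Definition naturally_isomorphic (C D : category) (F G : fdata C D) : Prop :=
  exists eta : forall X : C, Mor (F X) (G X),
    (forall X, is_iso (eta X)) /\
    (forall (X Y : C) (f : Mor X Y),
       meq (comp (eta Y) (fmor F f)) (comp (fmor G f) (eta X))).

(* [lmodType A] is the type of left [A]-modules, so right modules over [L] are
   objects of [lmodType L^c]. *)

Section Modules.
Variable A : pzRingType.
Implicit Types X Y Z P Q M N : lmodType A.

Definition lid X : {linear X -> X} := idfun.
Definition lcomp X Y Z (g : {linear Y -> Z}) (f : {linear X -> Y}) :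
  {linear X -> Z} := g \o f.

Definition lsurjective X Y (f : X -> Y) : Prop := forall y, exists x, f x = y.

Definition projective_mod P : Prop :=
  forall M N (g : {linear M -> N}) (f : {linear P -> N}), lsurjective g ->
  exists h : {linear P -> M}, forall x, g (h x) = f x.

Definition injective_mod Q : Prop :=
  forall M N (g : {linear M -> N}) (f : {linear M -> Q}), injective g ->
  exists h : {linear N -> Q}, forall x, h (g x) = f x.

Definition simple_mod M : Prop :=
  (exists x : M, x <> 0) /\
  forall S : {pred M}, GRing.submod_closed S ->
    (forall x, x \in S -> x = 0) \/ (forall x, x \in S).

Definition isomorphic_mod M N : Prop :=
  exists f : {linear M -> N}, bijective f.

(* [c 0 < c 1 < ... < c n] is a strict chain of submodules of [M] *)
Definition submod_chain M (n : nat) (c : nat -> {pred M}) : Prop :=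
  (forall i, (i <= n)%N -> GRing.submod_closed (c i)) /\
  (forall i, (i < n)%N -> {subset c i <= c i.+1} /\
     exists x, x \in c i.+1 /\ x \notin c i).

Definition finite_length M : Prop :=
  exists l : nat, forall n (c : nat -> {pred M}), submod_chain n c -> (n <= l)%N.

Lemma zero_finite_length M : (forall x : M, x = 0) -> finite_length M.
Proof.
move=> M0; exists 0%N => [[//|n]] c [cS]; move=> /(_ 0%N isT)[_ [x [_]]].
have [c0 _] := cS 0%N isT.
by rewrite (M0 x) c0.
Qed.

Lemma sub_finite_length M N (f : {linear M -> N}) :
  injective f -> finite_length N -> finite_length M.
Proof.
move=> fI [l Nl]; exists l => n c [cS cI]; pose d i : {pred N} :=
  fun y => `[< exists2 x, x \in c i & f x = y >].
apply: (Nl n d); split=> i le_in.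
  have [c0 cD] := cS i le_in; split.
    by apply/asboolP; exists 0; rewrite ?linear0.
  move=> a _ _ /asboolP[x xc <-] /asboolP[y yc <-]; apply/asboolP.
  by exists (a *: x + y); rewrite ?linearP //; apply: cD.
have [cc [x [xc xnc]]] := cI i le_in; split.
  by move=> _ /asboolP[y yc <-]; apply/asboolP; exists y => //; apply: cc.
exists (f x); split; first by apply/asboolP; exists x.
by apply/asboolP=> -[y yc /fI yx]; move: xnc; rewrite -yx yc.
Qed.

Lemma prod_finite_length M N :
  finite_length M -> finite_length N -> finite_length (M * N)%type.
Proof.
move=> [l Ml] [m Nm]; exists (l + m)%N => n c cch.
pose p i : {pred M} := fun x => `[< exists y, (x, y) \in c i >].
pose q i : {pred N} := fun y => (0, y) \in c i.
have pS i : (i <= n)%N -> GRing.submod_closed (p i).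
  move=> /(cch.1 i)[c0 cD]; split; first by apply/asboolP; exists 0.
  move=> a x x' /asboolP[y xy] /asboolP[y' xy'].
  by apply/asboolP; exists (a *: y + y'); apply: (cD a _ _ xy xy').
have qS i : (i <= n)%N -> GRing.submod_closed (q i).
  move=> /(cch.1 i)[c0 cD]; split; first exact: c0.
  move=> a y y' qy qy'.
  have := cD a (0, y) (0, y') qy qy'.
  rewrite [_ + _](_ : _ = (0, a *: y + y')) //.
  by congr (_, _); rewrite /= scaler0 addr0.
suff ab : exists a b u v, [/\ (n <= a + b)%N, submod_chain a u,
    submod_chain b v, u a = p n & v b = q n].
  have [a [b [u [v [le_n ua vb _ _]]]]] := ab.
  by apply: leq_trans le_n _; apply: leq_add; [apply: (Ml _ u) | apply: (Nm _ v)].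
elim: n {-2}n (leqnn n) cch pS qS => [|k IH] n.
  rewrite leqn0 => /eqP-> _ pS qS; exists 0%N, 0%N, (fun=> p 0%N), (fun=> q 0%N).
  by split=> //; split=> // i _; [apply: pS|apply: qS].
rewrite leq_eqVlt => /orP[/eqP->|]; last by rewrite ltnS; apply: IH.
move=> [cS cI] pS qS.
have cch' : submod_chain k c.
  by split=> i ik; [apply: cS; apply: leqW | apply: cI; apply: leqW].
have [||a [b [u [v [le_k ua vb eu ev]]]]] := IH k (leqnn k) cch'.
- by move=> i ik; apply: pS; apply: leqW.
- by move=> i ik; apply: qS; apply: leqW.
have [cc [[x y] [xyS xynS]]] := cI k (leqnn _).
have pp : {subset p k <= p k.+1}.
  by move=> z /asboolP[t zt]; apply/asboolP; exists t; apply: cc.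
have qq : {subset q k <= q k.+1} by move=> z; apply: cc.
pose ext (T : lmodType A) a (u : nat -> {pred T}) (w : {pred T}) i :=
  if (i <= a)%N then u i else w.
have extP (T : lmodType A) e (w : nat -> {pred T}) (z : {pred T}) :
    submod_chain e w -> GRing.submod_closed z -> {subset w e <= z} ->
    (exists t, t \in z /\ t \notin w e) ->
    submod_chain e.+1 (ext T e w z) /\ ext T e w z e.+1 = z.
  move=> [wS wI] zS wz zw; rewrite /ext /= ltnn; split=> //; split=> i.
    by move=> _; case: (leqP i e) => [ie|//]; apply: wS.
  rewrite ltnS leq_eqVlt => /orP[/eqP->|ie]; first by rewrite eqxx ltnn.
  by rewrite ie orbT; apply: wI.
have [px|pnx] := pselect (forall t, t \in p k.+1 -> t \in p k).
  have eqp : p k.+1 = p k by apply/funext=> t; apply/idP/idP; [apply: px|apply: pp].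
  have qn : exists t, t \in q k.+1 /\ t \notin v b.
    have /px/asboolP[y' xy'] : x \in p k.+1 by apply/asboolP; exists y.
    have [_ cD] := cS k.+1 (leqnn _); have [_ cD'] := cS k (leqnSn _).
    exists (y - y'); rewrite ev; split.
      have := cD (-1) _ _ (cc _ xy') xyS; rewrite scaleN1r.
      rewrite [_ + _](_ : _ = (0, y - y')) //.
      by congr (_, _); rewrite /= ?addNr // addrC.
    apply/negP=> qy; move/negP: xynS; apply.
    have := cD' 1 _ _ qy xy'; rewrite scale1r.
    rewrite [_ + _](_ : _ = (x, y)) //.
    by congr (_, _); rewrite /= ?add0r // subrK.
  have [||vb' ev'] := extP _ b v (q k.+1) vb _ _ qn.
  - exact: qS.
  - by rewrite ev.
  exists a, b.+1, u, (ext N b v (q k.+1)); split=> //; last by rewrite eu eqp.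
  by rewrite addnS ltnS.
have [t pt] : exists t, t \in p k.+1 /\ t \notin u a.
  apply: contra_notP pnx => pn t tp; apply: contraT => tn.
  by case: pn; exists t; rewrite eu.
have [|||ua' eu'] := extP _ a u (p k.+1) ua.
- exact: pS.
- by rewrite eu.
- by exists t.
have [qx|qnx] := pselect (forall t, t \in q k.+1 -> t \in q k).
  have eqq : q k.+1 = q k by apply/funext=> s; apply/idP/idP; [apply: qx|apply: qq].
  by exists a.+1, b, (ext M a u (p k.+1)), v; split=> //; rewrite ?ev ?eqq.
have [s qs] : exists t, t \in q k.+1 /\ t \notin v b.
  apply: contra_notP qnx => qn s sq; apply: contraT => sn.
  by case: qn; exists s; rewrite ev.
have [|||vb' ev'] := extP _ b v (q k.+1) vb.
- exact: qS.
- by rewrite ev.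
- by exists s.
exists a.+1, b.+1, (ext M a u (p k.+1)), (ext N b v (q k.+1)); split=> //.
by rewrite addnS addSn; apply: leqW.
Qed.

Section Kernel.
Variables (X Y : lmodType A) (f : {linear X -> Y}).

Definition ker_pred : {pred X} := fun x => f x == 0.

Lemma ker_pred_closed : GRing.submod_closed ker_pred.
Proof.
split; first by rewrite unfold_in /ker_pred linear0.
by move=> a x y; rewrite !unfold_in /ker_pred linearP => /eqP-> /eqP->; rewrite scaler0 addr0.
Qed.

HB.instance Definition _ := GRing.isSubmodClosed.Build A X ker_pred
  (GRing.submod_closed_semi ker_pred_closed).

Record ker := Ker { ker_val :> X; _ : ker_val \in ker_pred }.

HB.instance Definition _ := [isSub for ker_val].
HB.instance Definition _ := [Choice of ker by <:].
HB.instance Definition _ := [SubChoice_isSubLmodule of ker by <:].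

Definition ker_incl : {linear ker -> X} := val.

Definition im_pred : {pred Y} := fun y => `[< exists x, f x = y >].

Lemma im_pred_closed : GRing.submod_closed im_pred.
Proof.
split; first by apply/asboolP; exists 0; rewrite linear0.
move=> a _ _ /asboolP[x <-] /asboolP[y <-].
by apply/asboolP; exists (a *: x + y); rewrite linearP.
Qed.

HB.instance Definition _ := GRing.isSubmodClosed.Build A Y im_pred
  (GRing.submod_closed_semi im_pred_closed).

Definition coker := Quotient.quot im_pred.
HB.instance Definition _ := GRing.Zmodule.on coker.

Definition cpi (y : Y) : coker := \pi_coker y.

Lemma cpiP y y' : cpi y = cpi y' <-> exists x, f x = y - y'.
Proof.
split=> [/eqP|[x fx]].
  by rewrite /cpi -Quotient.idealrBE => /asboolP.
by apply/eqP; rewrite /cpi -Quotient.idealrBE; apply/asboolP; exists x.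
Qed.

Lemma cpi_surj q : exists y, cpi y = q.
Proof. by exists (repr q); rewrite /cpi reprK. Qed.

Lemma cpiD : {morph cpi : x y / x + y}.
Proof. by move=> x y; rewrite /cpi !piE. Qed.

Definition coker_scale (a : A) (q : coker) : coker := cpi (a *: repr q).

Lemma coker_scaleE a y : coker_scale a (cpi y) = cpi (a *: y).
Proof.
have /cpiP[x fx] : cpi (repr (cpi y)) = cpi y by rewrite /cpi reprK.
by apply/cpiP; exists (a *: x); rewrite linearZ /= fx scalerBr.
Qed.

Lemma coker_scaleA a b q :
  coker_scale a (coker_scale b q) = coker_scale (a * b) q.
Proof. by have [y <-] := cpi_surj q; rewrite !coker_scaleE scalerA. Qed.

Lemma coker_scale1 : left_id 1 coker_scale.
Proof. by move=> q; have [y <-] := cpi_surj q; rewrite coker_scaleE scale1r. Qed.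

Lemma coker_scaleDr : right_distributive coker_scale +%R.
Proof.
move=> a p q; have [x <-] := cpi_surj p; have [y <-] := cpi_surj q.
by rewrite -cpiD !coker_scaleE -cpiD scalerDr.
Qed.

Lemma coker_scaleDl q : {morph coker_scale^~ q : a b / a + b}.
Proof.
by move=> a b; have [y <-] := cpi_surj q; rewrite !coker_scaleE -cpiD scalerDl.
Qed.

HB.instance Definition _ := GRing.Zmodule_isLmodule.Build A coker
  coker_scaleA coker_scale1 coker_scaleDr coker_scaleDl.

Lemma cpi_is_linear : linear cpi.
Proof. by move=> a x y; rewrite cpiD -coker_scaleE. Qed.

HB.instance Definition _ :=
  GRing.isLinear.Build A Y coker *:%R cpi cpi_is_linear.

End Kernel.

Section CokerMap.
Variables (X Y X' Y' : lmodType A).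
Variables (f : {linear X -> Y}) (f' : {linear X' -> Y'}) (a : {linear Y -> Y'}).
Hypothesis af : forall x, exists x', f' x' = a (f x).

Definition coker_map_fun (q : coker f) : coker f' := cpi f' (a (repr q)).

Lemma coker_map_funE y : coker_map_fun (cpi f y) = cpi f' (a y).
Proof.
have /cpiP[x fx] : cpi f (repr (cpi f y)) = cpi f y by rewrite /cpi reprK.
by apply/cpiP; have [x' fx'] := af x; exists x'; rewrite fx' fx linearB.
Qed.

Lemma coker_map_is_linear : linear coker_map_fun.
Proof.
move=> r p q; have [x <-] := cpi_surj p; have [y <-] := cpi_surj q.
by rewrite -linearP !coker_map_funE !linearP.
Qed.

HB.instance Definition _ := GRing.isLinear.Build A (coker f) (coker f') *:%R
  coker_map_fun coker_map_is_linear.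

Definition coker_map : {linear coker f -> coker f'} := coker_map_fun.

End CokerMap.

Section KerLift.
Variables (X Y Z : lmodType A) (f : {linear X -> Y}) (a : {linear Z -> X}).
Hypothesis fa : forall z, f (a z) = 0.

Lemma ker_lift_subproof z : a z \in ker_pred f.
Proof. by apply/eqP. Qed.

Definition ker_lift_fun (z : Z) : ker f := Ker (ker_lift_subproof z).

Lemma ker_lift_is_linear : linear ker_lift_fun.
Proof. by move=> r x y; apply: val_inj; rewrite /= linearP. Qed.

HB.instance Definition _ := GRing.isLinear.Build A Z (ker f) *:%R
  ker_lift_fun ker_lift_is_linear.

Definition ker_lift : {linear Z -> ker f} := ker_lift_fun.

End KerLift.

Lemma ker_inclK (X Y : lmodType A) (f : {linear X -> Y}) (x : ker f) :
  f (ker_incl f x) = 0.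
Proof. by apply/eqP; apply: (valP x). Qed.

Section Pairing.
Variables (X Y Z : lmodType A).

Definition lpair_fun (f : {linear X -> Y}) (g : {linear X -> Z}) (x : X) :
  (Y * Z)%type := (f x, g x).

Lemma lpair_is_linear f g : linear (lpair_fun f g).
Proof. by move=> r x y; rewrite /lpair_fun !linearP. Qed.

HB.instance Definition _ f g := GRing.isLinear.Build A X (Y * Z)%type *:%R
  (lpair_fun f g) (lpair_is_linear f g).

Definition lpair f g : {linear X -> (Y * Z)%type} := lpair_fun f g.

Definition lcopair_fun (f : {linear X -> Z}) (g : {linear Y -> Z})
  (w : (X * Y)%type) : Z := f w.1 + g w.2.

Lemma lcopair_is_linear f g : linear (lcopair_fun f g).
Proof.
by move=> r x y; rewrite /lcopair_fun !linearP /= scalerDr addrACA.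
Qed.

HB.instance Definition _ f g := GRing.isLinear.Build A (X * Y)%type Z *:%R
  (lcopair_fun f g) (lcopair_is_linear f g).

Definition lcopair f g : {linear (X * Y)%type -> Z} := lcopair_fun f g.

End Pairing.

Definition Mod : category.
Proof.
refine (@Category (lmodType A) (fun X Y => {linear X -> Y})
  (fun X Y f g => forall x, f x = g x) lid (fun X Y Z g f => lcomp g f)
  _ _ _ _ _ _ _) => //.
- by move=> X Y f g h fg gh x; rewrite fg gh.
- by move=> X Y Z g g' f f' gg' ff' x; rewrite /= ff' gg'.
Defined.

(* Objects of [mod A] *)
Record modfl := ModFL {
  modfl_sort :> lmodType A;
  modflP : finite_length modfl_sort
}.

(* Quotient of a category of modules by the ideal of morphisms factoring
   through a module in the class [T]. *)
Section StableCategory.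
Variables (O : Type) (U : O -> lmodType A) (T : lmodType A -> Prop).
Hypothesis T0 : T 'rV[A]_0.
Hypothesis TD : forall M N, T M -> T N -> T (M * N)%type.

Definition stable_eq X Y (f g : {linear X -> Y}) : Prop :=
  exists (W : lmodType A) (a : {linear X -> W}) (b : {linear W -> Y}),
    T W /\ forall x, f x - g x = b (a x).

Definition stable_cat : category.
Proof.
refine (@Category O (fun X Y : O => {linear U X -> U Y})
  (fun (X Y : O) f g => stable_eq f g) (fun X : O => lid (U X))
  (fun (X Y Z : O) g f => lcomp g f) _ _ _ _ _ _ _).
- move=> X Y f; exists 'rV[A]_0, \0, \0; split=> // x.
  by rewrite subrr.
- move=> X Y f g [W [a [b [TW e]]]]; exists W, a, (\- b); split=> // x.
  by rewrite -opprB e.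
- move=> X Y f g h [W [a [b [TW e]]]] [W' [a' [b' [TW' e']]]].
  exists (W * W')%type.
  exists (lpair a a'), (lcopair b b'); split=> [|x]; first exact: TD.
  by rewrite /= /lcopair_fun /= -e -e' addrA subrK.
- move=> X Y Z g g' f f' [W [a [b [TW e]]]] [W' [a' [b' [TW' e']]]].
  exists (W * W')%type.
  exists (lpair (lcomp a f) a'), (lcopair b (lcomp g' b')); split=> [|x]; first exact: TD.
  by rewrite /= /lcopair_fun /= -e -e' linearB addrA subrK.
- by move=> X Y f; exists 'rV[A]_0, \0, \0; split=> // x; rewrite subrr.
- by move=> X Y f; exists 'rV[A]_0, \0, \0; split=> // x; rewrite subrr.
- by move=> X Y Z W h g f; exists 'rV[A]_0, \0, \0; split=> // x; rewrite subrr.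
Defined.

End StableCategory.
End Modules.

Section StableModuleCategories.
Variable A : pzRingType.
Implicit Types M N P Q : lmodType A.

Lemma row0_eq0 (x : 'rV[A]_0) : x = 0.
Proof. exact: thinmx0. Qed.

Lemma projective_row0 : projective_mod 'rV[A]_0.
Proof.
by move=> M N g f _; exists \0 => x; rewrite (row0_eq0 x) !linear0.
Qed.

Lemma projective_prod P Q :
  projective_mod P -> projective_mod Q -> projective_mod (P * Q)%type.
Proof.
move=> pP pQ M N g f gs.
have [h hE] := pP _ _ g (lcomp f (lpair (lid P) \0)) gs.
have [k kE] := pQ _ _ g (lcomp f (lpair \0 (lid Q))) gs.
exists (lcopair h k) => -[x y]; rewrite /= /lcopair_fun linearD hE kE /=.
by rewrite -linearD /lpair_fun; congr (f (_, _)); rewrite /= ?addr0 ?add0r.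
Qed.

Lemma injective_row0 : injective_mod 'rV[A]_0.
Proof. by move=> M N g f _; exists \0 => x; rewrite (row0_eq0 (f x)). Qed.

Lemma injective_prod P Q :
  injective_mod P -> injective_mod Q -> injective_mod (P * Q)%type.
Proof.
move=> pP pQ M N g f gi.
have [h hE] := pP _ _ g (lcomp (lcopair (lid P) \0) f) gi.
have [k kE] := pQ _ _ g (lcomp (lcopair \0 (lid Q)) f) gi.
exists (lpair h k) => x; rewrite /= /lpair_fun hE kE /= /lcopair_fun /=.
by case: (f x) => a b /=; rewrite addr0 add0r.
Qed.

Definition projective_fl M : Prop := finite_length M /\ projective_mod M.

Lemma projective_fl_row0 : projective_fl 'rV[A]_0.
Proof.
by split; [apply: zero_finite_length row0_eq0 | apply: projective_row0].
Qed.

Lemma projective_fl_prod P Q :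
  projective_fl P -> projective_fl Q -> projective_fl (P * Q)%type.
Proof.
move=> [lP pP] [lQ pQ].
by split; [apply: prod_finite_length | apply: projective_prod].
Qed.

(* The projectively stable category of [mod A] *)
Definition pstab_mod : category :=
  stable_cat (@modfl_sort A) projective_fl_row0 projective_fl_prod.

(* The projectively and injectively stable categories of all [A]-modules.  For
   an Artin algebra [A] those of [mod A] are full subcategories of them, since
   modules of finite length have projective covers and injective envelopes of
   finite length. *)
Definition pstab_Mod : category :=
  @stable_cat A (lmodType A) id _ projective_row0 projective_prod.

Definition istab_Mod : category :=
  @stable_cat A (lmodType A) id _ injective_row0 injective_prod.

Record projective_resolution (X : lmodType A) := ProjectiveResolution {
  res_mod :> nat -> lmodType A;
  res_dif : forall n, {linear res_mod n.+1 -> res_mod n};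
  res_aug : {linear res_mod 0 -> X};
  res_projective : forall n, projective_mod (res_mod n);
  res_aug_surj : lsurjective res_aug;
  res_exact0 : forall y, res_aug y = 0 <-> exists x, res_dif 0 x = y;
  res_exact : forall n y,
    res_dif n y = 0 <-> exists x, res_dif n.+1 x = y
}.

(* Ext^(k+1)_A(X, Y) = 0, as the cohomology in degree k+1 of Hom_A(P, Y) for a
   projective resolution P of X *)
Definition Ext_succ_eq0 (k : nat) (X Y : lmodType A) : Prop :=
  forall (P : projective_resolution X) (f : {linear P k.+1 -> Y}),
    (forall x, f (res_dif P k.+1 x) = 0) ->
    exists g : {linear P k -> Y}, forall x, g (res_dif P k x) = f x.

Record subcategory (C : modfl A -> Prop) : Prop := Subcategory {
  subcategory_zero : forall X : modfl A, (forall x : X, x = 0) -> C X;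
  subcategory_sum : forall (X Y Z : modfl A) (f : {linear (X * Y)%type -> Z}),
    C X -> C Y -> bijective f -> C Z;
  subcategory_summand : forall (X Y : modfl A)
    (i : {linear X -> Y}) (p : {linear Y -> X}),
    C Y -> (forall x, p (i x) = x) -> C X
}.

Definition contravariantly_finite (C : modfl A -> Prop) : Prop :=
  forall X : modfl A, exists (Y : modfl A) (f : {linear Y -> X}),
    C Y /\ forall (Y' : modfl A) (g : {linear Y' -> X}), C Y' ->
      exists h : {linear Y' -> Y}, forall y, f (h y) = g y.

Definition covariantly_finite (C : modfl A -> Prop) : Prop :=
  forall X : modfl A, exists (Y : modfl A) (f : {linear X -> Y}),
    C Y /\ forall (Y' : modfl A) (g : {linear X -> Y'}), C Y' ->
      exists h : {linear Y -> Y'}, forall x, h (f x) = g x.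

(* The index [k] with [k.+1 < d] stands for the degree k+1 in {1, ..., d-1}. *)
Record cluster_tilting (d : nat) (C : modfl A -> Prop) : Prop :=
  ClusterTilting {
  ct_subcategory : subcategory C;
  ct_contravariantly_finite : contravariantly_finite C;
  ct_covariantly_finite : covariantly_finite C;
  ct_left : forall X : modfl A, C X <->
    forall k, (k.+1 < d)%N -> forall Y : modfl A, C Y -> Ext_succ_eq0 k X Y;
  ct_right : forall Y : modfl A, C Y <->
    forall k, (k.+1 < d)%N -> forall X : modfl A, C X -> Ext_succ_eq0 k X Y
}.

Record presentation (X : modfl A) := Presentation {
  pres0 : modfl A;
  pres1 : modfl A;
  pres_aug : {linear pres0 -> X};
  pres_dif : {linear pres1 -> pres0};
  pres0_projective : projective_mod pres0;
  pres1_projective : projective_mod pres1;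
  pres_aug_surj : lsurjective pres_aug;
  pres_exact : forall y, pres_aug y = 0 <-> exists x, pres_dif x = y
}.

Section Lifts.
Variable pres : forall X : modfl A, presentation X.
Variables (X Y : modfl A) (f : {linear X -> Y}).

Lemma lift0_subproof :
  exists g : {linear pres0 (pres X) -> pres0 (pres Y)},
    forall x, pres_aug (pres Y) (g x) = f (pres_aug (pres X) x).
Proof.
have [g gE] := pres0_projective (lcomp f (pres_aug (pres X)))
  (@pres_aug_surj _ (pres Y)).
by exists g => x; rewrite gE.
Qed.

Definition lift0 := sval (cid lift0_subproof).

Lemma lift0E x : pres_aug (pres Y) (lift0 x) = f (pres_aug (pres X) x).
Proof. exact: (svalP (cid lift0_subproof)). Qed.

Lemma pres_dif0 (Z : modfl A) x :
  pres_aug (pres Z) (pres_dif (pres Z) x) = 0.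
Proof. by apply/pres_exact; exists x. Qed.

Lemma lift1_subproof :
  exists g : {linear pres1 (pres X) -> pres1 (pres Y)},
    forall x, pres_dif (pres Y) (g x) = lift0 (pres_dif (pres X) x).
Proof.
have kerY := @pres_dif0 Y.
have kerX x : pres_aug (pres Y) (lcomp lift0 (pres_dif (pres X)) x) = 0.
  by rewrite /= lift0E pres_dif0 linear0.
have [|g gE] := pres1_projective (g := ker_lift kerY) (ker_lift kerX).
  move=> z; have /pres_exact[x xz] := ker_inclK z.
  by exists x; apply: val_inj.
by exists g => x; have /(congr1 val) := gE x.
Qed.

Definition lift1 := sval (cid lift1_subproof).

Lemma lift1E x :
  pres_dif (pres Y) (lift1 x) = lift0 (pres_dif (pres X) x).
Proof. exact: (svalP (cid lift1_subproof)). Qed.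

Lemma syzygy_map_subproof (z : ker (pres_aug (pres X))) :
  pres_aug (pres Y) (lcomp lift0 (ker_incl _) z) = 0.
Proof. by rewrite /= lift0E ker_inclK linear0. Qed.

Definition syzygy_map :
    {linear ker (pres_aug (pres X)) -> ker (pres_aug (pres Y))} :=
  ker_lift syzygy_map_subproof.

End Lifts.

Lemma ker_finite_length (X Y : lmodType A) (f : {linear X -> Y}) :
  finite_length X -> finite_length (ker f).
Proof. by apply: (sub_finite_length (f := ker_incl f)); apply: val_inj. Qed.

Definition Omega (pres : forall X : modfl A, presentation X) :
    fdata pstab_mod pstab_mod :=
  @FData pstab_mod pstab_mod
    (fun X => ModFL (ker_finite_length (pres_aug (pres X))
                       (modflP (pres0 (pres X)))))
    (fun X Y f => syzygy_map pres f).

End StableModuleCategories.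

Section Hom.
Variables (A : pzRingType) (X Y : lmodType A).

Definition hom := {linear X -> Y}.

HB.instance Definition _ := gen_eqMixin hom.
HB.instance Definition _ := gen_choiceMixin hom.

Lemma homP (f g : hom) : (forall x, f x = g x) -> f = g.
Proof.
case: f g => f [[fD] [fZ]] [g [[gD] [gZ]]] /= /funext fg.
by subst g; congr (GRing.Linear.Pack (GRing.Linear.Class _ _));
  congr (_ _); apply: Prop_irrelevance.
Qed.

Definition hom_add (f g : hom) : hom := f \+ g.
Definition hom_opp (f : hom) : hom := \- f.
Definition hom_zero : hom := \0.

Lemma hom_addA : associative hom_add.
Proof. by move=> f g h; apply: homP => x /=; rewrite addrA. Qed.
Lemma hom_addC : commutative hom_add.
Proof. by move=> f g; apply: homP => x /=; rewrite addrC. Qed.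
Lemma hom_add0 : left_id hom_zero hom_add.
Proof. by move=> f; apply: homP => x /=; rewrite add0r. Qed.
Lemma hom_addN : left_inverse hom_zero hom_opp hom_add.
Proof. by move=> f; apply: homP => x /=; rewrite addNr. Qed.

HB.instance Definition _ :=
  GRing.isZmodule.Build hom hom_addA hom_addC hom_add0 hom_addN.

End Hom.

Section ArtinAlgebraModules.
Variables (R : comNzRingType) (L : algType R).

(* Hom_L(X, Y), for right modules, as an [R]-module *)
Section HomR.
Variables X Y : lmodType L^c.

Definition homR := hom X Y.
HB.instance Definition _ := GRing.Zmodule.on homR.

Definition homR_scale_fun (r : R) (f : homR) (x : X) : Y :=
  (r%:A : L^c) *: (f : hom X Y) x.

Lemma homR_scale_is_linear r f : linear (homR_scale_fun r f).
Proof.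
move=> a x y; rewrite /homR_scale_fun linearP scalerDr !scalerA; congr (_ *: _ + _).
by change (@GRing.mul L a r%:A = @GRing.mul L r%:A a); rewrite mulr_algl mulr_algr.
Qed.

HB.instance Definition _ r f := GRing.isLinear.Build L^c X Y *:%R
  (homR_scale_fun r f) (homR_scale_is_linear r f).

Definition homR_scale (r : R) (f : homR) : homR :=
  (homR_scale_fun r f : {linear X -> Y}).

Lemma homR_scaleA a b f :
  homR_scale a (homR_scale b f) = homR_scale (a * b) f.
Proof.
apply: homP => x; rewrite /= /homR_scale_fun /= /homR_scale_fun scalerA.
congr (_ *: _); change (@GRing.mul L b%:A a%:A = (a * b)%:A).
by rewrite mulr_algr scalerA.
Qed.

Lemma homR_scale1 : left_id 1 homR_scale.
Proof.
move=> f; apply: homP => x; rewrite /= /homR_scale_fun scale1r.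
exact: (@scale1r L^c).
Qed.

Lemma homR_scaleDr : right_distributive homR_scale +%R.
Proof. by move=> a f g; apply: homP => x; rewrite /= /homR_scale_fun scalerDr. Qed.

Lemma homR_scaleDl f : {morph homR_scale^~ f : a b / a + b}.
Proof.
by move=> a b; apply: homP => x; rewrite /= /homR_scale_fun scalerDl scalerDl.
Qed.

HB.instance Definition _ := GRing.Zmodule_isLmodule.Build R homR
  homR_scaleA homR_scale1 homR_scaleDr homR_scaleDl.

End HomR.

Section HomRMap.
Variables (X Y X' Y' : lmodType L^c) (u : {linear X' -> X}) (v : {linear Y -> Y'}).

Definition homR_map_fun (f : homR X Y) : homR X' Y' := lcomp v (lcomp f u).

Lemma homR_map_is_linear : linear homR_map_fun.
Proof.
by move=> r f g; apply: homP => x; rewrite /= /homR_scale_fun /= linearP.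
Qed.

HB.instance Definition _ := GRing.isLinear.Build R (homR X Y) (homR X' Y') *:%R
  homR_map_fun homR_map_is_linear.

Definition homR_map : {linear homR X Y -> homR X' Y'} := homR_map_fun.

End HomRMap.

(* The left [L]-module X^* = Hom_L(X, L) of a right module [X], with
   (l *: f)(x) = l * f x.  The right regular module is [L^c]^o. *)
Section Star.
Variable X : lmodType L^c.

Definition star := hom X (L^c)^o.
HB.instance Definition _ := GRing.Zmodule.on star.

Definition star_scale_fun (a : L) (f : star) (x : X) : (L^c)^o :=
  a * ((f : hom X (L^c)^o) x : L).

Lemma star_scale_is_linear a f : linear (star_scale_fun a f).
Proof.
move=> b x y; rewrite /star_scale_fun linearP /=.
by rewrite [LHS](@mulrDr L) (@mulrA L).
Qed.

HB.instance Definition _ a f := GRing.isLinear.Build L^c X (L^c)^o *:%R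
  (star_scale_fun a f) (star_scale_is_linear a f).

Definition star_scale (a : L) (f : star) : star :=
  (star_scale_fun a f : {linear X -> (L^c)^o}).

Lemma star_scaleA a b f : star_scale a (star_scale b f) = star_scale (a * b) f.
Proof. by apply: homP => x; rewrite /= /star_scale_fun /= /star_scale_fun mulrA. Qed.

Lemma star_scale1 : left_id 1 star_scale.
Proof. by move=> f; apply: homP => x; rewrite /= /star_scale_fun mul1r. Qed.

Lemma star_scaleDr : right_distributive star_scale +%R.
Proof.
by move=> a f g; apply: homP => x; rewrite /= /star_scale_fun [LHS](@mulrDr L).
Qed.

Lemma star_scaleDl f : {morph star_scale^~ f : a b / a + b}.
Proof.
by move=> a b; apply: homP => x; rewrite /= /star_scale_fun [LHS](@mulrDl L).
Qed.

HB.instance Definition _ := GRing.Zmodule_isLmodule.Build L star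
  star_scaleA star_scale1 star_scaleDr star_scaleDl.

End Star.

Section StarMap.
Variables (X Y : lmodType L^c) (u : {linear X -> Y}).

Definition star_map_fun (f : star Y) : star X := lcomp f u.

Lemma star_map_is_linear : linear star_map_fun.
Proof. by move=> r f g; apply: homP. Qed.

HB.instance Definition _ := GRing.isLinear.Build L (star Y) (star X) *:%R
  star_map_fun star_map_is_linear.

Definition star_map : {linear star Y -> star X} := star_map_fun.

End StarMap.

(* The [R]-module underlying a left [L]-module *)
Section Restriction.
Variable M : lmodType L.

Definition res : Type := M.
HB.instance Definition _ := GRing.Zmodule.on res.

Definition res_scale (r : R) (m : res) : res := (r%:A : L) *: (m : M).

Lemma res_scaleA a b m : res_scale a (res_scale b m) = res_scale (a * b) m.
Proof. by rewrite /res_scale scalerA mulr_algl scalerA. Qed.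

Lemma res_scale1 : left_id 1 res_scale.
Proof. by move=> m; rewrite /res_scale scale1r; apply: scale1r. Qed.

Lemma res_scaleDr : right_distributive res_scale +%R.
Proof. by move=> a m n; apply: scalerDr. Qed.

Lemma res_scaleDl m : {morph res_scale^~ m : a b / a + b}.
Proof. by move=> a b; rewrite /res_scale scalerDl; apply: scalerDl. Qed.

HB.instance Definition _ := GRing.Zmodule_isLmodule.Build R res
  res_scaleA res_scale1 res_scaleDr res_scaleDl.

End Restriction.

Variable I : lmodType R.

(* The dual D V = Hom_R(V, I) of an [R]-module *)
Section DualR.
Variable V : lmodType R.

Definition dualR := hom V I.
HB.instance Definition _ := GRing.Zmodule.on dualR.

Definition dualR_scale_fun (r : R) (f : dualR) (x : V) : I :=
  r *: (f : hom V I) x.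

Lemma dualR_scale_is_linear r f : linear (dualR_scale_fun r f).
Proof.
move=> a x y; rewrite /dualR_scale_fun linearP scalerDr !scalerA.
by rewrite mulrC.
Qed.

HB.instance Definition _ r f := GRing.isLinear.Build R V I *:%R
  (dualR_scale_fun r f) (dualR_scale_is_linear r f).

Definition dualR_scale (r : R) (f : dualR) : dualR :=
  (dualR_scale_fun r f : {linear V -> I}).

Lemma dualR_scaleA a b f :
  dualR_scale a (dualR_scale b f) = dualR_scale (a * b) f.
Proof. by apply: homP => x; rewrite /= /dualR_scale_fun /= /dualR_scale_fun scalerA. Qed.

Lemma dualR_scale1 : left_id 1 dualR_scale.
Proof. by move=> f; apply: homP => x; rewrite /= /dualR_scale_fun scale1r. Qed.

Lemma dualR_scaleDr : right_distributive dualR_scale +%R.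
Proof. by move=> a f g; apply: homP => x; rewrite /= /dualR_scale_fun scalerDr. Qed.

Lemma dualR_scaleDl f : {morph dualR_scale^~ f : a b / a + b}.
Proof. by move=> a b; apply: homP => x; rewrite /= /dualR_scale_fun scalerDl. Qed.

HB.instance Definition _ := GRing.Zmodule_isLmodule.Build R dualR
  dualR_scaleA dualR_scale1 dualR_scaleDr dualR_scaleDl.

End DualR.

Section DualRMap.
Variables (V W : lmodType R) (u : {linear V -> W}).

Definition dualR_map_fun (f : dualR W) : dualR V := lcomp f u.

Lemma dualR_map_is_linear : linear dualR_map_fun.
Proof. by move=> r f g; apply: homP. Qed.

HB.instance Definition _ := GRing.isLinear.Build R (dualR W) (dualR V) *:%R
  dualR_map_fun dualR_map_is_linear.

Definition dualR_map : {linear dualR W -> dualR V} := dualR_map_fun.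

End DualRMap.

Definition DR : fdata (op (Mod R)) (Mod R) :=
  @FData (op (Mod R)) (Mod R) (fun V => dualR V) (fun V W f => dualR_map f).

(* The right [L]-module D M = Hom_R(M, I) of a left [L]-module *)
Section DualL.
Variable M : lmodType L.

Definition dualL := hom (res M) I.
HB.instance Definition _ := GRing.Zmodule.on dualL.

Definition dualL_scale_fun (a : L^c) (f : dualL) (x : res M) : I :=
  (f : hom (res M) I) ((a : L) *: (x : M)).

Lemma dualL_scale_is_linear a f : linear (dualL_scale_fun a f).
Proof.
move=> r x y; rewrite /dualL_scale_fun.
have -> : (a : L) *: ((r *: x + y : res M) : M)
        = (r *: (((a : L) *: (x : M)) : res M) + ((a : L) *: (y : M) : res M)) :> res M.
  rewrite [LHS](@scalerDr L M); congr (_ + _).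
  rewrite [LHS](@scalerA L M) [RHS](@scalerA L M).
  by rewrite mulr_algr mulr_algl.
by rewrite linearP.
Qed.

HB.instance Definition _ a f := GRing.isLinear.Build R (res M) I *:%R
  (dualL_scale_fun a f) (dualL_scale_is_linear a f).

Definition dualL_scale (a : L^c) (f : dualL) : dualL :=
  (dualL_scale_fun a f : {linear res M -> I}).

Lemma dualL_scaleA a b f :
  dualL_scale a (dualL_scale b f) = dualL_scale (a * b) f.
Proof.
by apply: homP => x; rewrite /= /dualL_scale_fun /= /dualL_scale_fun scalerA.
Qed.

Lemma dualL_scale1 : left_id 1 dualL_scale.
Proof.
move=> f; apply: homP => x; rewrite /= /dualL_scale_fun.
by rewrite [_ *: _](@scale1r L M).
Qed.

Lemma dualL_scaleDr : right_distributive dualL_scale +%R.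
Proof. by move=> a f g; apply: homP. Qed.

Lemma dualL_scaleDl f : {morph dualL_scale^~ f : a b / a + b}.
Proof.
move=> a b; apply: homP => x; rewrite /= /dualL_scale_fun.
by rewrite [_ *: _](@scalerDl L M) linearD.
Qed.

HB.instance Definition _ := GRing.Zmodule_isLmodule.Build L^c dualL
  dualL_scaleA dualL_scale1 dualL_scaleDr dualL_scaleDl.

End DualL.

Section DualLMap.
Variables (M N : lmodType L) (u : {linear M -> N}).

Definition res_map_fun (x : res M) : res N := u (x : M).

Lemma res_map_is_linear : linear res_map_fun.
Proof. by move=> r x y; rewrite /res_map_fun [LHS]linearP. Qed.

HB.instance Definition _ := GRing.isLinear.Build R (res M) (res N) *:%R
  res_map_fun res_map_is_linear.

Definition dualL_map_fun (f : dualL N) : dualL M :=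
  lcomp f (res_map_fun : {linear res M -> res N}).

Lemma dualL_map_is_linear : linear dualL_map_fun.
Proof.
move=> a f g; apply: homP => x.
by rewrite /= /dualL_scale_fun /= /res_map_fun linearZ.
Qed.

HB.instance Definition _ := GRing.isLinear.Build L^c (dualL N) (dualL M) *:%R
  dualL_map_fun dualL_map_is_linear.

Definition dualL_map : {linear dualL N -> dualL M} := dualL_map_fun.

End DualLMap.

Definition DL : fdata (op (pstab_Mod L)) (istab_Mod L^c) :=
  @FData (op (pstab_Mod L)) (istab_Mod L^c) (fun M => dualL M)
    (fun M N f => dualL_map f).

Section Translation.
Variable pres : forall X : modfl L^c, presentation X.

Definition transpose (X : modfl L^c) : lmodType L :=
  coker (star_map (pres_dif (pres X))).

Section TransposeMap.
Variables (X Y : modfl L^c) (f : {linear X -> Y}).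

Lemma transpose_map_subproof (g : star (pres0 (pres Y))) :
  exists h : star (pres0 (pres X)),
    star_map (pres_dif (pres X)) h
    = star_map (lift1 pres f) (star_map (pres_dif (pres Y)) g).
Proof.
by exists (star_map (lift0 pres f) g); apply: homP => x; rewrite /= lift1E.
Qed.

Definition transpose_map : {linear transpose Y -> transpose X} :=
  coker_map transpose_map_subproof.

End TransposeMap.

(* Tr depends on the chosen presentations only up to isomorphism in the stable
   category; on a morphism it is induced by a chosen lift to presentations. *)
Definition Tr : fdata (pstab_mod L^c) (op (pstab_Mod L)) :=
  @FData (pstab_mod L^c) (op (pstab_Mod L)) transpose
    (fun X Y f => transpose_map f).

Definition tau (d : nat) : fdata (pstab_mod L^c) (istab_Mod L^c) :=
  fcomp DL (fcomp Tr (fiter d.-1 (Omega pres))).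

End Translation.

Section DExact.
Variables (C : modfl L^c -> Prop) (d : nat).

(* The sequence X_0 -> X_1 -> ... -> X_(d+1), with X_0 = L, X_i = M^i and
   X_(d+1) = N, is encoded as a complex which is zero in degrees > d+1. *)
Record dexact := DExact {
  dx_ob :> nat -> modfl L^c;
  dx_dif : forall i, {linear dx_ob i -> dx_ob i.+1};
  dx_in : forall i, (i <= d.+1)%N -> C (dx_ob i);
  dx_zero : forall i, (d.+1 < i)%N -> forall x : dx_ob i, x = 0;
  dx_complex : forall i x, dx_dif i.+1 (dx_dif i x) = 0;
  dx_contra_mono : forall X : modfl L^c, C X ->
    forall g : {linear X -> dx_ob 0},
    (forall x, dx_dif 0 (g x) = 0) -> forall x, g x = 0;
  dx_contra_exact : forall X : modfl L^c, C X -> forall i, (i < d)%N ->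
    forall g : {linear X -> dx_ob i.+1}, (forall x, dx_dif i.+1 (g x) = 0) ->
    exists h : {linear X -> dx_ob i}, forall x, dx_dif i (h x) = g x;
  dx_co_mono : forall X : modfl L^c, C X ->
    forall g : {linear dx_ob d.+1 -> X},
    (forall x, g (dx_dif d x) = 0) -> forall x, g x = 0;
  dx_co_exact : forall X : modfl L^c, C X -> forall i, (i < d)%N ->
    forall g : {linear dx_ob i.+1 -> X}, (forall x, g (dx_dif i x) = 0) ->
    exists h : {linear dx_ob i.+2 -> X}, forall x, h (dx_dif i.+1 x) = g x
}.

Record chain_map (D E : dexact) := ChainMap {
  cm_map :> forall i, {linear D i -> E i};
  cm_comm : forall i x, cm_map i.+1 (dx_dif D i x) = dx_dif E i (cm_map i x)
}.

Definition homotopic (D E : dexact) (f g : chain_map D E) : Prop :=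
  exists h : forall i, {linear D i.+1 -> E i},
    (forall x, f 0 x - g 0 x = h 0 (dx_dif D 0 x)) /\
    (forall i x,
       f i.+1 x - g i.+1 x = dx_dif E i (h i x) + h i.+1 (dx_dif D i.+1 x)).

Definition chain_id (D : dexact) : chain_map D D :=
  @ChainMap D D (fun i => lid (D i)) (fun i x => erefl).

Lemma chain_comp_subproof (D E F : dexact) (g : chain_map E F)
    (f : chain_map D E) i x :
  lcomp (g i.+1) (f i.+1) (dx_dif D i x) = dx_dif F i (lcomp (g i) (f i) x).
Proof. by rewrite /= !cm_comm. Qed.

Definition chain_comp (D E F : dexact) (g : chain_map E F)
    (f : chain_map D E) : chain_map D F :=
  @ChainMap D F (fun i => lcomp (g i) (f i)) (chain_comp_subproof g f).

Lemma homotopic_of_eq (D E : dexact) (f g : chain_map D E) :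
  (forall i x, f i x = g i x) -> homotopic f g.
Proof.
move=> fg; exists (fun i => \0); split=> [x|i x]; rewrite fg subrr //=.
by rewrite linear0 addr0.
Qed.

Definition KdEx : category.
Proof.
refine (@Category dexact chain_map (fun D E => @homotopic D E) chain_id
  (fun D E F => @chain_comp D E F) _ _ _ _ _ _ _).
- by move=> D E f; apply: homotopic_of_eq.
- move=> D E f g [h [h0 hS]]; exists (fun i => \- (h i)).
  by split=> [x|i x]; rewrite -opprB ?h0 ?hS //= linearN opprD.
- move=> D E f g k [h [h0 hS]] [h' [h0' hS']].
  exists (fun i => h i \+ h' i); split=> [x|i x] /=.
    by rewrite -h0 -h0' addrA subrK.
  by rewrite linearD addrACA -hS -hS' addrA subrK.
- move=> D E F g g' f f' [k [k0 kS]] [h [h0 hS]].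
  exists (fun i => lcomp (k i) (f i.+1) \+ lcomp (g' i) (h i)).
  split=> [x|i x] /=.
    by rewrite cm_comm -k0 -h0 linearB addrA subrK.
  rewrite linearD addrACA (cm_comm f) -(cm_comm g') -kS -linearD -hS linearB.
  by rewrite addrA subrK.
- by move=> D E f; apply: homotopic_of_eq.
- by move=> D E f; apply: homotopic_of_eq.
- by move=> D E F G h g f; apply: homotopic_of_eq.
Defined.

(* Value at X of the contravariant defect, as an [R]-module *)
Definition contra_defect (D : dexact) (X : lmodType L^c) : lmodType R :=
  coker (homR_map (lid X) (dx_dif D d)).

(* Value at Y of the covariant defect, as an [R]-module *)
Definition co_defect (D : dexact) (Y : lmodType L^c) : lmodType R :=
  coker (homR_map (dx_dif D 0) (lid Y)).

Section DefectMaps.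
Variables (D E : dexact) (f : chain_map D E).

Section Contra.
Variables (X Y : lmodType L^c) (u : {linear X -> Y}).

Lemma contra_defect_map_subproof (g : homR Y (D d)) :
  exists h : homR X (E d), homR_map (lid X) (dx_dif E d) h
    = homR_map u (f d.+1) (homR_map (lid Y) (dx_dif D d) g).
Proof.
by exists (homR_map u (f d) g); apply: homP => x; rewrite /= cm_comm.
Qed.

Definition contra_defect_map :
    {linear contra_defect D Y -> contra_defect E X} :=
  coker_map contra_defect_map_subproof.

End Contra.

Section Co.
Variables (X Y : lmodType L^c) (u : {linear X -> Y}).

Lemma co_defect_map_subproof (g : homR (E 1) X) :
  exists h : homR (D 1) Y, homR_map (dx_dif D 0) (lid Y) h
    = homR_map (f 0) u (homR_map (dx_dif E 0) (lid X) g).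
Proof.
by exists (homR_map (f 1) u g); apply: homP => x; rewrite /= cm_comm.
Qed.

Definition co_defect_map : {linear co_defect E X -> co_defect D Y} :=
  coker_map co_defect_map_subproof.

End Co.
End DefectMaps.

(* The full subcategory of the projectively stable category on [C] *)
Definition pstab_sub : category := @full_sub (pstab_mod L^c) C.

(* (delta, X) |-> delta^*(X), which is contravariant in X *)
Definition contra_defect_fdata :
    fdata (prodC (op KdEx) pstab_sub) (op (Mod R)) :=
  @FData (prodC (op KdEx) pstab_sub) (op (Mod R))
    (fun p => contra_defect p.1 (sval p.2))
    (fun p q f => contra_defect_map f.1 f.2).

(* (delta, Y) |-> delta_*(Y) *)
Definition co_defect_fdata :
    fdata (prodC (op KdEx) (istab_Mod L^c)) (Mod R) :=
  @FData (prodC (op KdEx) (istab_Mod L^c)) (Mod R)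
    (fun p => co_defect p.1 p.2)
    (fun p q f => co_defect_map f.1 f.2).

Variable pres : forall X : modfl L^c, presentation X.

(* (delta, X) |-> D delta^*(X) *)
Definition dual_contra_defect : fdata (prodC (op KdEx) pstab_sub) (Mod R) :=
  fcomp DR contra_defect_fdata.

(* (delta, X) |-> delta_*(tau_d X) *)
Definition co_defect_tau : fdata (prodC (op KdEx) pstab_sub) (Mod R) :=
  fcomp co_defect_fdata
    (fprod (fid (op KdEx)) (fcomp (tau pres d) (@fincl (pstab_mod L^c) C))).

End DExact.
End ArtinAlgebraModules.

(* [F] is a functor to the full subcategory mod R of Mod R. *)
Definition functor_to_mod (R : pzRingType) (C : category)
    (F : fdata C (Mod R)) : Prop :=
  is_functor F /\ forall X : C, finite_length (F X : lmodType R).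

Definition artinian_ring (R : comNzRingType) : Prop :=
  forall c : nat -> {pred R^o},
    (forall n, GRing.submod_closed (c n)) ->
    (forall n, {subset c n.+1 <= c n}) ->
    exists n, forall m, (n <= m)%N -> c m =i c n.

Definition finitely_generated (A : pzRingType) (M : lmodType A) : Prop :=
  exists (n : nat) (v : 'I_n -> M),
    forall x, exists a : 'I_n -> A, x = \sum_i a i *: v i.

Definition artin_algebra (R : comNzRingType) (L : algType R) : Prop :=
  artinian_ring R /\ finitely_generated (L : lmodType R).

Section Envelope.
Variable A : pzRingType.

(* [B], with the maps [u j], is the direct sum of the modules [S j]. *)
Definition direct_sum (J : Type) (S : J -> lmodType A) (B : lmodType A)
    (u : forall j, {linear S j -> B}) : Prop :=
  forall (N : lmodType A) (g : forall j, {linear S j -> N}),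
    exists h : {linear B -> N}, (forall j x, h (u j x) = g j x) /\
      forall h' : {linear B -> N},
        (forall j x, h' (u j x) = g j x) -> forall b, h' b = h b.

Definition simple_representatives (J : Type) (S : J -> lmodType A) : Prop :=
  [/\ forall j, simple_mod (S j),
      forall j k, isomorphic_mod (S j) (S k) -> j = k
    & forall M : lmodType A, simple_mod M ->
        exists j, isomorphic_mod M (S j)].

Definition injective_envelope (B I : lmodType A) (e : {linear B -> I}) : Prop :=
  [/\ injective e, injective_mod I
    & forall S : {pred I}, GRing.submod_closed S ->
        (exists x, x \in S /\ x <> 0) ->
        exists b, e b \in S /\ e b <> 0].

Definition envelope_of_simples (I : lmodType A) : Prop :=
  exists (J : Type) (S : J -> lmodType A) (B : lmodType A)
    (u : forall j, {linear S j -> B}) (e : {linear B -> I}),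
    [/\ simple_representatives S, direct_sum u & injective_envelope e].

End Envelope.

(* Main.v *)
(** Let P_d -> ... -> P_0 -> X be the resolution by the chosen presentations, and
E(Y) the cokernel of Hom(P_(d-1), Y) -> Hom(P_d, Y), so that E(Y) = Y ⊗ Tr_d X
and D E(Y) = Hom(Y, tau_d X).  Lifting a map X -> N to a chain map P_i ->
M^(d-i), P_d -> L, along the exact sequence delta identifies delta^*(X) with
the kernel of E(L) -> E(M^1), because Ext^k(X, -) vanishes on the terms of
delta for 0 < k < d.  As I is injective, D delta^*(X) is the cokernel of
D E(M^1) -> D E(L), that is of Hom(M^1, tau_d X) -> Hom(L, tau_d X).

That delta is exact at N requires an injective cogenerator D(Λ) in M, hence
that Λ has finite length.  This holds because every simple module is covered
by a projective of finite length: the right ideal of the elements of Λ lying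
in the image of such a projective is then in no maximal right ideal. *)

Require Import Defs.
From HB Require Import structures.
From mathcomp Require Import all_boot all_order all_algebra.
From mathcomp Require Import boolp classical_sets.
From mathcomp Require Import ring.

Set Implicit Arguments.
Unset Strict Implicit.
Unset Printing Implicit Defensive.

Import GRing.Theory.
Local Open Scope ring_scope.

(** * Submodules and linear maps *)

(** A lift P_d -> L of a map X -> N is determined only up to homotopy, and the tensor product Y ⊗
    Tr_d X is not constructed. Both difficulties are met by relations: [full_stair] relates a map to
    all of its lifts, [represents] relates a map to tau_d X with a functional on Hom(P_d, -), and
    [duality] composes the two. A linear relation that is total on both sides and relates 0 only to
    0 is the graph of an isomorphism. Naturality becomes stability of the relation under the induced
    maps, which is seen by composing witnesses, whatever lifts were chosen.

    Functoriality and finite length are verified for D delta^* and carried along the isomorphism to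
    delta_*(tau_d X), where a direct proof would have to compare the lifts chosen in [Omega] and
    [Tr]. *)

Section Submodule.
Variables (A : pzRingType) (M : lmodType A) (U : {pred M}).
Hypothesis U_closed : GRing.submod_closed U.

(** The proof of closedness is an argument, so that the submodule instance can be attached to an
    arbitrary predicate. *)
Definition sub_pred of GRing.submod_closed U : {pred M} := U.

HB.instance Definition _ := GRing.isSubmodClosed.Build A M (sub_pred U_closed)
  (GRing.submod_closed_semi U_closed).

Record submodule :=
  Submodule { submodule_val :> M; _ : submodule_val \in sub_pred U_closed }.

HB.instance Definition _ := [isSub for submodule_val].
HB.instance Definition _ := [Choice of submodule by <:].
HB.instance Definition _ := [SubChoice_isSubLmodule of submodule by <:].

Definition submM : lmodType A := submodule.
Definition submodule_incl : {linear submM -> M} := val.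

Lemma submodule_incl_inj : injective submodule_incl.
Proof. exact: val_inj. Qed.

Lemma submodule_inclP x : x \in U <-> exists s, submodule_incl s = x.
Proof.
split=> [xU|[s <-]]; last exact: (valP s).
by exists (Submodule (xU : x \in sub_pred U_closed)).
Qed.

End Submodule.

Section LinearMaps.
Variable A : pzRingType.
Implicit Types M N P Q X Y Z : lmodType A.

Lemma lmapZ X Y (f : {linear X -> Y}) a x : f (a *: x) = a *: f x.
Proof. exact: linearZZ. Qed.

Lemma lmap_sum X Y (f : {linear X -> Y}) T (s : seq T) (F : T -> X) :
  f (\sum_(t <- s) F t) = \sum_(t <- s) f (F t).
Proof. exact: linear_sum. Qed.

(** Makes linear maps available inside proofs, where no canonical instance can be declared. *)
Lemma linear_fun X Y (f : X -> Y) : linear f ->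
  exists g : {linear X -> Y}, forall x, g x = f x.
Proof.
move=> fL; pose m := GRing.isLinear.Build A X Y *:%R f fL.
by exists (HB.pack_for {linear X -> Y} f m).
Qed.

(** Two values at x differ by a value at 0, so any choice function for the relation is linear. This
    handles every map below that is defined through arbitrary choices. *)
Lemma linear_relation X Y (r : X -> Y -> Prop) :
    (forall x, exists y, r x y) ->
    (forall a x x' y y', r x y -> r x' y' -> r (a *: x + x') (a *: y + y')) ->
    (forall y, r 0 y -> y = 0) ->
  exists g : {linear X -> Y}, forall x, r x (g x).
Proof.
move=> /choice[g rg] rD r0.
have rU x y y' : r x y -> r x y' -> y = y'.
  move=> rxy rxy'; have := rD (-1) _ _ _ _ rxy' rxy.
  by rewrite !scaleN1r addNr addrC => /r0/eqP; rewrite subr_eq0 => /eqP.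
have [|f fE] := linear_fun (f := g); first by move=> a x y; apply: rU (rD _ _ _ _ _ _ _); exact: rg.
by exists f => x; rewrite fE.
Qed.

Lemma desc_surjective X Y Z (p : {linear X -> Y}) (g : {linear X -> Z}) :
    lsurjective p -> (forall x, p x = 0 -> g x = 0) ->
  exists h : {linear Y -> Z}, forall x, h (p x) = g x.
Proof.
move=> pS pg.
have [y|a _ _ _ _ [x [<- <-]] [x' [<- <-]]|_ [x [/pg gx <-]]|h hE] :=
    @linear_relation Y Z (fun y z => exists x, p x = y /\ g x = z).
- by have [x px] := pS y; exists (g x), x.
- by exists (a *: x + x'); rewrite !linearP.
- by [].
exists h => x; have [x' [px gx]] := hE (p x).
by rewrite -gx; apply/eqP; rewrite -subr_eq0 -linearB pg // linearB px subrr.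
Qed.

Lemma linear_inj X Y (f : {linear X -> Y}) :
  (forall x, f x = 0 -> x = 0) -> injective f.
Proof.
move=> f0 x y fxy; apply/eqP; rewrite -subr_eq0; apply/eqP/f0.
by rewrite linearB fxy subrr.
Qed.

(* A module structure in place of its carrier: in the type of a linear map, a
   carrier would be followed by a reversed coercion, which blocks rewriting. *)
Definition cokM X Y (f : {linear X -> Y}) : lmodType A := coker f.
Definition cokpi X Y (f : {linear X -> Y}) : {linear Y -> cokM f} := cpi f.

Lemma cokpi_surj X Y (f : {linear X -> Y}) : lsurjective (cokpi f).
Proof. exact: cpi_surj. Qed.

Lemma cokpi_eq0 X Y (f : {linear X -> Y}) y :
  cokpi f y = 0 <-> exists x, f x = y.
Proof.
rewrite -[0](linear0 (cokpi f)).
split=> [/cpiP|] [x fx]; first by exists x; rewrite fx subr0.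
by apply/cpiP; exists x; rewrite fx subr0.
Qed.

Lemma desc_coker X Y Z (f : {linear X -> Y}) (g : {linear Y -> Z}) :
    (forall x, g (f x) = 0) ->
  exists h : {linear cokM f -> Z}, forall y, h (cokpi f y) = g y.
Proof.
move=> gf; apply: desc_surjective; first exact: cokpi_surj.
by move=> y /cokpi_eq0[x <-].
Qed.

(** Injectivity of [Q] is applied to the induced map X / ker f -> Y. *)
Lemma ext_injective X Y Q (f : {linear X -> Y}) (g : {linear X -> Q}) :
    injective_mod Q -> (forall x, f x = 0 -> g x = 0) ->
  exists h : {linear Y -> Q}, forall x, h (f x) = g x.
Proof.
move=> iQ fg; have UC := ker_pred_closed f; pose i := submodule_incl UC.
have iE x : f x = 0 <-> exists u, i u = x.
  by rewrite -(submodule_inclP UC); split=> /eqP.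
have [x|g' g'E] := @desc_coker _ _ _ i g; first by apply/fg/iE; exists x.
have [x|f' f'E] := @desc_coker _ _ _ i f; first by apply/iE; exists x.
have f'I : injective f'.
  apply: linear_inj => q; have [x <-] := cokpi_surj q; rewrite f'E => fx.
  by apply/cokpi_eq0/iE.
have [h hE] := iQ _ _ f' g' f'I.
by exists h => x; rewrite -g'E -f'E hE.
Qed.

Lemma corestrict X Y (U : {pred Y}) (UC : GRing.submod_closed U)
    (f : {linear X -> Y}) : (forall x, f x \in U) ->
  exists f' : {linear X -> submM UC}, forall x, submodule_incl UC (f' x) = f x.
Proof.
move=> fU.
have inj := @submodule_incl_inj _ _ _ UC.
apply: (@linear_relation X _ (fun x u => submodule_incl UC u = f x)).
- by move=> x; apply/submodule_inclP.
- by move=> a x x' y y' e e'; rewrite !linearP e e'.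
- by move=> u; rewrite linear0 => iu; apply: inj; rewrite iu linear0.
Qed.

(** Both maps are corestricted to the image of [f], onto which [f] is surjective. *)
Lemma lift_projective P X Y (f : {linear X -> Y}) (a : {linear P -> Y}) :
    projective_mod P -> (forall p, exists x, f x = a p) ->
  exists h : {linear P -> X}, forall p, f (h p) = a p.
Proof.
move=> pP fa; have UC := im_pred_closed f.
have [x|f' f'E] := @corestrict _ _ _ UC f; first by apply/asboolP; exists x.
have [p|a' a'E] := @corestrict _ _ _ UC a; first by apply/asboolP.
have [|h hE] := pP _ _ f' a'.
  move=> u; have /asboolP[x fx] : submodule_incl UC u \in im_pred f.
    by apply/(submodule_inclP UC); exists u.
  by exists x; apply: (@submodule_incl_inj _ _ _ UC); rewrite f'E fx.
by exists h => p; rewrite -f'E hE a'E.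
Qed.

Definition regular_mod : lmodType A := A^o.

Lemma projective_regular : projective_mod regular_mod.
Proof.
move=> M N g f gS; have [m gm] := gS (f 1).
have [|h hE] := @linear_fun regular_mod M (fun a : A => a *: m).
  by move=> a x y; rewrite scalerDl scalerA.
exists h => x; rewrite hE linearZ gm -linearZ.
by rewrite /= /GRing.scale /= mulr1.
Qed.

End LinearMaps.

(** * Modules of finite length *)

Section FiniteLength.
Variable A : pzRingType.
Implicit Types K M N P S W : lmodType A.

Lemma submod_closed_preim M N (f : {linear M -> N}) (U : {pred N}) :
  GRing.submod_closed U -> GRing.submod_closed [pred x | f x \in U].
Proof.
move=> [U0 UD]; split; first by rewrite inE linear0.
by move=> a x y; rewrite !inE linearP => ? ?; apply: UD.
Qed.

Lemma submod_closed_image M N (f : {linear M -> N}) (U : {pred M}) :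
  GRing.submod_closed U ->
  GRing.submod_closed (fun y : N => `[< exists2 x, x \in U & f x = y >]).
Proof.
move=> [U0 UD]; split; first by apply/asboolP; exists 0; rewrite ?linear0.
move=> a _ _ /asboolP[x xU <-] /asboolP[y yU <-]; apply/asboolP.
by exists (a *: x + y); rewrite ?linearP //; apply: UD.
Qed.

Lemma submod_chain_rcons M n (c : nat -> {pred M}) (U : {pred M}) :
    submod_chain n c -> GRing.submod_closed U -> {subset c n <= U} ->
    (exists x, x \in U /\ x \notin c n) ->
  submod_chain n.+1 (fun i => if (i <= n)%N then c i else U).
Proof.
move=> [cS cI] US sU nU; split=> i.
  by move=> _; case: (leqP i n) => [le_in|//]; apply: cS.
rewrite /= ltnS leq_eqVlt => /orP[/eqP->|lt_in]; first by rewrite eqxx ltnn.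
by rewrite lt_in orbT; apply: cI.
Qed.

(** Deleting repetitions makes a weak chain strict; a bound on strict chains thus bounds the number
    of strict steps of a weak one. *)
Lemma submod_chain_strict M n (c : nat -> {pred M}) :
    (forall i, (i <= n)%N -> GRing.submod_closed (c i)) ->
    (forall i, (i < n)%N -> {subset c i <= c i.+1}) ->
  exists d, d (count (fun i => `[< exists x, x \in c i.+1 /\ x \notin c i >])
                     (iota 0 n)) = c n /\
    submod_chain (count (fun i => `[< exists x, x \in c i.+1 /\ x \notin c i >])
                     (iota 0 n)) d.
Proof.
elim: n => [|n IH] cS cI.
  by exists (fun=> c 0%N); split=> //; split=> // i _; apply: (cS 0%N).
have [|i lt_in|d [dn dP]] := IH; first by move=> i le_in; apply/cS/leqW.
  by apply/cI/leqW.
rewrite -addn1 iotaD count_cat /= add0n addn0 addn1.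
set k := count _ _ in dn dP *.
case: asboolP => [st|nst]; last first.
  exists d; rewrite addn0 dn; split=> //; apply/funext=> x; apply/idP/idP.
    exact: cI.
  by move=> xS; apply: contraT => xn; case: nst; exists x.
rewrite addn1; eexists; split; last first.
  apply: (submod_chain_rcons dP (cS n.+1 (leqnn _))); rewrite dn => //.
  exact: cI.
by rewrite /= ltnn.
Qed.

(** A chain of M is moved to N by [f] and pulled back to K by [p]; it stays strict because [p]
    reaches all of f(M). *)
Lemma subquotient_finite_length K M N (f : {linear M -> N}) (p : {linear K -> N}) :
    injective f -> (forall x, exists k, p k = f x) ->
  finite_length K -> finite_length M.
Proof.
move=> fI fp [l Kl]; exists l => n c [cS cI].
apply: (Kl n (fun i => [pred k | `[< exists2 x, x \in c i & f x = p k >]])).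
split=> i le_in.
  exact: (submod_closed_preim p (submod_closed_image f (cS i le_in))).
have [cc [x [xS xn]]] := cI i le_in; split.
  by move=> k /asboolP[y yc yk]; apply/asboolP; exists y => //; apply: cc.
have [k kx] := fp x; exists k; split; first by apply/asboolP; exists x.
by apply/asboolP => -[y yc]; rewrite kx => /fI yx; rewrite -yx yc in xn.
Qed.

Lemma quotient_finite_length M N (p : {linear M -> N}) :
  lsurjective p -> finite_length M -> finite_length N.
Proof. by move=> pS; apply: (@subquotient_finite_length M N N (lid N) p). Qed.

(** Each strict step of a chain in M is strict in its preimage in K or in its image in N. *)
Lemma extension_finite_length K M N (f : {linear K -> M}) (g : {linear M -> N}) :
    (forall x, g x = 0 -> exists k, f k = x) ->
  finite_length K -> finite_length N -> finite_length M.
Proof.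
move=> ex [k Kk] [l Nl]; exists (k + l)%N => n c [cS cI].
pose u i : {pred K} := [pred x | f x \in c i].
pose v i : {pred N} := fun y => `[< exists2 x, x \in c i & g x = y >].
have [||d [_ /Kk du]] := @submod_chain_strict K n u.
- by move=> i le_in; apply: (submod_closed_preim f (cS i le_in)).
- by move=> i le_in x; rewrite !inE; apply: (cI i le_in).1.
have [||d' [_ /Nl dv]] := @submod_chain_strict N n v.
- by move=> i le_in; apply: (submod_closed_image g (cS i le_in)).
- move=> i le_in y /asboolP[x xc xy]; apply/asboolP; exists x => //.
  exact: (cI i le_in).1.
apply: leq_trans (leq_add du dv); rewrite -count_predUI.
apply: leq_trans (leq_addr _ _); rewrite -{1}(size_iota 0 n) -count_predT.
suff /allP : all (predU (fun i => `[< exists x, x \in u i.+1 /\ x \notin u i >])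
    (fun i => `[< exists y, y \in v i.+1 /\ y \notin v i >])) (iota 0 n).
  by move=> /eq_in_count->.
apply/allP => i; rewrite mem_iota add0n => lt_in /=; apply/orP.
have [cc [x [xS xn]]] := cI i lt_in.
have [|nv] := asboolP (exists y, y \in v i.+1 /\ y \notin v i); first by right.
left; apply/asboolP.
have : g x \in v i.
  by apply: contraT => gx; case: nv; exists (g x); split=> //; apply/asboolP; exists x.
case/asboolP=> y yc gy.
have [|z zE] := ex (x - y); first by rewrite linearB gy subrr.
have [_ DS] := cS _ lt_in; have [_ DI] := cS _ (ltnW lt_in).
exists z; rewrite !inE zE; split.
  by have := DS (-1) _ _ (cc _ yc) xS; rewrite scaleN1r addrC.
apply: contra xn => xy; by have := DI 1 _ _ xy yc; rewrite scale1r subrK.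
Qed.

Definition nonzero_submod M (U : {pred M}) : Prop :=
  GRing.submod_closed U /\ exists x, x \in U /\ x <> 0.

(** Without a minimal submodule below [U], strict chains of every length could be built downwards
    from [U]. *)
Lemma minimal_submod M (U : {pred M}) : finite_length M -> nonzero_submod U ->
  exists V, [/\ nonzero_submod V, {subset V <= U}
    & forall T, nonzero_submod T -> {subset T <= V} -> {subset V <= T}].
Proof.
move=> [l Ml] nzU; apply: contrapT => noV.
suff ch n : forall V, nonzero_submod V -> {subset V <= U} ->
    exists c, submod_chain n c /\ c n = V.
  by have [c [/Ml]] := ch l.+1 U nzU (fun x xU => xU); rewrite ltnn.
elim: n => [|n IH] V nzV sVU.
  by exists (fun=> V); split=> //; split=> // i _; case: nzV.
have [T [nzT sTV nVT]] :
    exists T, [/\ nonzero_submod T, {subset T <= V} & ~ {subset V <= T}].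
  apply: contrapT => noT; apply: noV; exists V; split=> // T nzT sTV.
  by apply: contrapT => nVT; apply: noT; exists T.
have [c [cP cn]] := IH T nzT (fun x xT => sVU x (sTV x xT)).
eexists; split.
  apply: (submod_chain_rcons cP (proj1 nzV)); rewrite cn //.
  apply: contrapT => nx; apply: nVT => x xV; apply: contraT => xT.
  by case: nx; exists x.
by rewrite /= ltnn.
Qed.

Lemma simple_submodule M : finite_length M -> (exists x : M, x <> 0) ->
  exists S (i : {linear S -> M}), simple_mod S /\ injective i.
Proof.
move=> flM [x x0].
have [|V [[VC [y [yV y0]]] _ minV]] := @minimal_submod M predT flM.
  by split; [split | exists x].
exists (submM VC), (submodule_incl VC); split; last exact: submodule_incl_inj.
have [s sy] := (submodule_inclP VC y).1 yV; split.
  by exists s => s0; apply: y0; rewrite -sy s0 linear0.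
move=> T TC; have TC' := submod_closed_image (submodule_incl VC) TC.
have [nz|z] := pselect (exists t, t \in T /\ t <> 0); last first.
  by left=> t tT; apply: contrapT => t0; apply: z; exists t.
right=> t; pose f := submodule_incl VC.
have nzT : nonzero_submod (fun y => `[< exists2 x, x \in T & f x = y >]).
  split=> //; case: nz => u [uT u0]; exists (f u).
  split; first by apply/asboolP; exists u.
  by rewrite -(linear0 f) => /submodule_incl_inj.
have sT : {subset (fun y => `[< exists2 x, x \in T & f x = y >]) <= V}.
  by move=> _ /asboolP[u _ <-]; apply/submodule_inclP; exists u.
have ftV : f t \in V by apply/submodule_inclP; exists t.
by have /asboolP[u uT /submodule_incl_inj<-] := minV _ nzT sT (f t) ftV.
Qed.

Lemma finite_length_ind (P : lmodType A -> Prop) :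
    (forall M, (forall x : M, x = 0) -> P M) ->
    (forall S M N (i : {linear S -> M}) (p : {linear M -> N}),
       simple_mod S -> injective i -> lsurjective p ->
       (forall x, p x = 0 <-> exists s, i s = x) -> P N -> P M) ->
  forall M, finite_length M -> P M.
Proof.
move=> P0 PS M [l]; elim: l M => [|l IH] M Ml.
  apply: P0 => x; apply: contrapT => x0.
  pose c i : {pred M} := if i is 0%N then pred1 0 else predT.
  suff /Ml : submod_chain 1 c by [].
  split=> [[|i] _|[|//] _]; first split=> [|a y z]; rewrite ?inE //.
    by move=> /eqP-> /eqP->; rewrite scaler0 addr0.
  by split=> //; exists x; split=> //; apply/eqP.
have [z|nz] := pselect (forall x : M, x = 0); first exact: P0.
have [||S [i [simpS iI]]] := @simple_submodule M; first by exists l.+1.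
  by apply: contrapT => h; apply: nz => x; apply: contrapT => x0; apply: h; exists x.
apply: (PS S M (cokM i) i (cokpi i)) => //.
- exact: cokpi_surj.
- exact: cokpi_eq0.
apply: IH => n c [cS cI]; rewrite -ltnS.
(* A chain of M / S is pulled back to M and preceded by 0. The new step is strict because every
   preimage contains S, so the bound drops by one. *)
pose d k : {pred M} := if k is k'.+1 then [pred x | cokpi i x \in c k'] else pred1 0.
apply: (Ml _ d); split=> [[|k] le_kn|[|k] le_kn].
- by split=> [|a y z]; rewrite ?inE // => /eqP-> /eqP->; rewrite scaler0 addr0.
- exact: (submod_closed_preim (cokpi i) (cS k le_kn)).
- have [c0 _] := cS 0%N isT; split.
    by move=> x /eqP->; rewrite /d inE linear0.
  have [[s s0] _] := simpS; exists (i s); split.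
    by rewrite /d inE (_ : cokpi i (i s) = 0) //; apply/cokpi_eq0; exists s.
  by apply/eqP; rewrite -(linear0 i) => /iI.
have [cc [x [xS xn]]] := cI k le_kn; split; first by move=> y; apply: cc.
by have [y yx] := cokpi_surj x; exists y; rewrite /d !inE yx.
Qed.

(** Iterated binary products let facts about A^n follow by induction from those about products of
    two modules. *)
Fixpoint free_mod n : lmodType A :=
  if n is n'.+1 then (regular_mod A * free_mod n')%type : lmodType A else 'rV[A]_0.

Lemma projective_free n : projective_mod (free_mod n).
Proof.
elim: n => [|n IH]; first exact: projective_row0.
by apply: projective_prod IH; apply: projective_regular.
Qed.

Lemma simple_generated S : simple_mod S -> forall s : S, s <> 0 ->
  forall t, exists a, a *: s = t.
Proof.
move=> [_ simpS] s s0 t.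
have [|z|U] := simpS (fun t => `[< exists a, a *: s = t >]).
- split; first by apply/asboolP; exists 0; rewrite scale0r.
  move=> a _ _ /asboolP[x <-] /asboolP[y <-]; apply/asboolP.
  by exists (a * x + y); rewrite scalerDl scalerA.
- by case: s0; apply: z; apply/asboolP; exists 1; rewrite scale1r.
by have /asboolP := U t.
Qed.

(** A cover of the quotient lifts to M by projectivity, and one more copy of A covers the simple
    submodule. *)
Lemma finite_length_cover M : finite_length M ->
  exists n (p : {linear free_mod n -> M}), lsurjective p.
Proof.
elim/finite_length_ind: M / => [M M0|S M N i p simpS _ pS ex [n [q qS]]].
  by exists 0%N, \0 => x; exists 0; rewrite (M0 x).
have [q' q'E] := @projective_free n _ _ p q pS.
have [[s s0] _] := simpS.
have [|r rE] := @linear_fun _ (regular_mod A) M (fun a : A => a *: i s).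
  by move=> a x y; rewrite scalerDl scalerA.
exists n.+1, (lcopair r q') => x.
have [z qz] := qS (p x).
have /ex[t tx] : p (x - q' z) = 0 by rewrite linearB q'E qz subrr.
have [a ats] := simple_generated simpS s0 t.
by exists (a, z); rewrite /= /lcopair_fun /= rE -linearZ ats tx subrK.
Qed.

(** M is a quotient of the product of the modules that reach its finitely many generators. *)
Lemma finite_length_of_generators M : finitely_generated M ->
    (forall x : M, exists W (p : {linear W -> M}),
       finite_length W /\ exists w, p w = x) ->
  finite_length M.
Proof.
move=> [n [v vP]] cov.
suff [W [p [flW pv]]] : exists W (p : {linear W -> M}), finite_length W /\
    forall i, i \in enum 'I_n -> exists w, p w = v i.
  apply: (quotient_finite_length (p := p)) flW => x; have [a ->] := vP x.
  have /choice[w wE] i : exists w, p w = v i by apply: pv; rewrite mem_enum.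
  by exists (\sum_i a i *: w i); rewrite lmap_sum; apply: eq_bigr => i _; rewrite lmapZ wE.
elim: (enum _) => [|j s [W [p [flW pv]]]].
  exists 'rV[A]_0, \0; split=> //; exact: zero_finite_length (@row0_eq0 A).
have [W' [p' [flW' [w' w'E]]]] := cov (v j).
exists (W' * W)%type, (lcopair p' p); split; first exact: prod_finite_length.
move=> i; rewrite inE => /orP[/eqP->|/pv[w wE]].
  by exists (w', 0); rewrite /= /lcopair_fun /= linear0 addr0.
by exists (0, w); rewrite /= /lcopair_fun /= linear0 add0r.
Qed.

End FiniteLength.

(** * Dual bases of projective modules *)

Section DualBasis.
Variable A : pzRingType.
Implicit Types M N P Q : lmodType A.

(** The finite dual basis property: it makes Y ⊗ P^* -> Hom(P, Y) surjective, and stands in for the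
    tensor product throughout. *)
Definition has_dual_basis P : Prop :=
  exists s : seq (P * {linear P -> regular_mod A}),
    forall p, p = \sum_(t <- s) (t.2 p : A) *: t.1.

Lemma dual_basis_retract P Q (i : {linear P -> Q}) (r : {linear Q -> P}) :
  (forall p, r (i p) = p) -> has_dual_basis Q -> has_dual_basis P.
Proof.
move=> ri [s sE]; exists [seq (r t.1, lcomp t.2 i) | t <- s] => p.
rewrite -{1}(ri p) {1}(sE (i p)) lmap_sum big_map.
by apply: eq_bigr => t _; rewrite lmapZ.
Qed.

Lemma dual_basis_prod P Q :
  has_dual_basis P -> has_dual_basis Q -> has_dual_basis (P * Q)%type.
Proof.
move=> [s sE] [s' s'E].
have [p1 p1E] : exists f : {linear (P * Q)%type -> P}, forall p, f p = p.1.
  exact: linear_fun.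
have [p2 p2E] : exists f : {linear (P * Q)%type -> Q}, forall p, f p = p.2.
  exact: linear_fun.
pose i1 : {linear P -> (P * Q)%type} := lpair (lid P) \0.
pose i2 : {linear Q -> (P * Q)%type} := lpair \0 (lid Q).
exists ([seq (i1 t.1, lcomp t.2 p1) | t <- s] ++
        [seq (i2 t.1, lcomp t.2 p2) | t <- s']) => p.
rewrite big_cat !big_map /=.
transitivity (i1 (p1 p) + i2 (p2 p)).
  rewrite p1E p2E; case: p => x y.
  by congr (_, _); rewrite /= ?addr0 ?add0r.
rewrite {1}(sE (p1 p)) {1}(s'E (p2 p)) !lmap_sum.
by congr (_ + _); apply: eq_bigr => t _; rewrite lmapZ.
Qed.

Lemma dual_basis_free n : has_dual_basis (free_mod A n).
Proof.
elim: n => [|n IH]; first by exists [::] => p; rewrite (row0_eq0 p) big_nil.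
apply: dual_basis_prod IH; exists [:: (1 : regular_mod A, lid _)] => p.
by rewrite big_seq1 /= [RHS]mulr1.
Qed.

Lemma projective_dual_basis P :
  projective_mod P -> finite_length P -> has_dual_basis P.
Proof.
move=> pP /finite_length_cover[n [p pS]].
have [i iE] := pP _ _ p (lid P) pS.
exact: dual_basis_retract iE (@dual_basis_free n).
Qed.

End DualBasis.

(** * Maximal submodules and the length of the regular module *)

Section RegularModule.
Local Open Scope classical_set_scope.
Variable A : pzRingType.
Implicit Types M N P : lmodType A.

Lemma maximal_submod M (U : {pred M}) (x : M) :
    GRing.submod_closed U -> x \notin U ->
  exists V : {pred M}, [/\ GRing.submod_closed V, {subset U <= V}, x \notin V &
    forall W : {pred M}, GRing.submod_closed W -> {subset V <= W} ->
      x \notin W -> {subset W <= V}].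
Proof.
move=> [U0 UD] xU.
(* Adjoining [U] to each set lets the union of the empty chain, the empty set, satisfy [P]. *)
pose E (V : set M) : {pred M} := fun y => (y \in U) || `[< V y >].
pose P (V : set M) := GRing.submod_closed (E V) /\ x \notin E V.
have [F FP totF|V [[VC xV] maxV]] := @Zorn_bigcup M P.
  split; last first.
    apply/negP => /orP[|/asboolP[V /FP[_]]]; first exact/negP.
    by move=> /negP xV Vx; apply: xV; apply/orP; right; apply/asboolP.
  split; first by apply/orP; left.
  have EP y : y \in E (\bigcup_(X in F) X) ->
      y \in U \/ exists2 V, F V & V y.
    by move=> /orP[|/asboolP]; [left | right].
  have EF V y : F V -> y \in E V -> y \in E (\bigcup_(X in F) X).
    move=> FV /orP[yU|/asboolP yV]; apply/orP; first by left.
    by right; apply/asboolP; exists V.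
  move=> a u v /EP[uU|[V FV Vu]] /EP[vU|[W FW Wv]].
  - by apply/orP; left; apply: UD.
  - apply: (EF W) => //; apply: (FP _ FW).1.2; apply/orP; first by left.
    by right; apply/asboolP.
  - apply: (EF V) => //; apply: (FP _ FV).1.2; apply/orP; last by left.
    by right; apply/asboolP.
  have [VW|WV] := totF _ _ FV FW.
    by apply: (EF W) => //; apply: (FP _ FW).1.2; apply/orP; right; apply/asboolP => //; apply: VW.
  by apply: (EF V) => //; apply: (FP _ FV).1.2; apply/orP; right; apply/asboolP => //; apply: WV.
exists (E V); split=> //; first by move=> y yU; apply/orP; left.
move=> W WC sVW xW y yW; apply: contraT => yV.
case: (maxV [set z | z \in W]).
  split=> [z Vz|/(_ y yW) Vy]; first by apply: sVW; apply/orP; right; apply/asboolP.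
  by move/negP: yV; apply; apply/orP; right; apply/asboolP.
have EW : E [set z | z \in W] = W.
  apply/funext => z; apply/orP/idP => [[zU|/asboolP//]|zW]; last first.
    by right; apply/asboolP.
  by apply: sVW; apply/orP; left.
by rewrite /P EW.
Qed.

Lemma simple_finite_length M : simple_mod M -> finite_length M.
Proof.
move=> [_ simpM]; exists 1%N => n c [cS cI]; rewrite leqNgt; apply/negP => n1.
have [_ [x [x1 x0]]] := cI 0%N (ltnW n1).
have [_ [y [_ y1]]] := cI 1%N n1.
have [z|all1] := simpM _ (cS 1%N (ltnW n1)); last by rewrite all1 in y1.
by rewrite (z x x1) (cS 0%N isT).1 in x0.
Qed.

(* The elements of [A] in the image of a projective module of finite length
   form a right ideal; a simple quotient of [A] killing it would lift along its
   projective cover. *)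
Lemma regular_finite_length :
    (forall X : modfl A, exists (P : lmodType A) (p : {linear P -> X}),
       projective_fl P /\ lsurjective p) ->
  finite_length (regular_mod A).
Proof.
move=> cov.
pose T : {pred regular_mod A} := fun y =>
  `[< exists (P : lmodType A) (p : {linear P -> regular_mod A}),
  projective_fl P /\ exists x, p x = y >].
have TC : GRing.submod_closed T.
  split.
    apply/asboolP; exists 'rV[A]_0, \0; split; first exact: projective_fl_row0.
    by exists 0.
  move=> a _ _ /asboolP[P [p [pP [x <-]]]] /asboolP[P' [p' [pP' [x' <-]]]].
  apply/asboolP; exists (P * P')%type, (lcopair p p').
  split; first exact: projective_fl_prod.
  by exists (a *: x, x'); rewrite /= /lcopair_fun lmapZ.
have [/asboolP[P [p [[flP _] [x px]]]]|T1] := boolP ((1 : regular_mod A) \in T).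
  apply: (quotient_finite_length (p := p)) flP => a; exists ((a : A) *: x).
  by rewrite lmapZ px [LHS]mulr1.
have [V [VC sTV V1 maxV]] := maximal_submod TC T1.
pose q := cokpi (submodule_incl VC).
have qV y : q y = 0 <-> y \in V.
  by split=> [/cokpi_eq0/submodule_inclP|/(submodule_inclP VC)/cokpi_eq0].
have simpQ : simple_mod (cokM (submodule_incl VC)).
  split; first by exists (q 1) => /qV; apply/negP.
  move=> S SC; have [q1|q1] := boolP (q 1 \in S).
    right=> y; have [a <-] := cokpi_surj y.
    have -> : cokpi (submodule_incl VC) a = (a : A) *: q 1.
      by rewrite -linearZ /= [in RHS]/GRing.scale /= mulr1.
    by have [S0 SD] := SC; rewrite -[_ *: _]addr0; apply: SD.
  left=> y; have [a <-] := cokpi_surj y => aS; apply/qV.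
  apply: (maxV [pred z | q z \in S]) => //.
    exact: (submod_closed_preim q SC).
  by move=> z /qV zV; rewrite inE zV; have [] := SC.
have [P [p [[flP pP] pS]]] := cov (ModFL (simple_finite_length simpQ)).
have [|h hE] := pP _ _ q p; first exact: cokpi_surj.
have [x px] := pS (q 1).
case/negP: V1; apply/qV; rewrite -px -hE; apply/qV/sTV/asboolP.
by exists P, h; split=> //; exists x.
Qed.

End RegularModule.

(** * Finite length over the base ring *)

Section HomFiniteLength.
Variables (R : comNzRingType) (L : algType R).
Hypothesis artinL : artin_algebra L.
Implicit Types X Y S M : lmodType L^c.

Definition homM X Y : lmodType R := homR X Y.
Definition homM_map X Y X' Y' (u : {linear X' -> X}) (v : {linear Y -> Y'}) :
  {linear homM X Y -> homM X' Y'} := homR_map u v.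

Lemma homME X Y (r : R) (f : homM X Y) x :
  ((r *: f : homM X Y) : {linear X -> Y}) x
  = (r%:A : L^c) *: (f : {linear X -> Y}) x.
Proof. by []. Qed.

Lemma homMD X Y (f g : homM X Y) x :
  ((f + g : homM X Y) : {linear X -> Y}) x
  = (f : {linear X -> Y}) x + (g : {linear X -> Y}) x.
Proof. by []. Qed.

Lemma homM_apply X Y (f g : homM X Y) : f = g ->
  forall x, (f : {linear X -> Y}) x = (g : {linear X -> Y}) x.
Proof. by move=> ->. Qed.

Lemma homM_sumE X Y T (s : seq T) (F : T -> homM X Y) x :
  ((\sum_(t <- s) F t : homM X Y) : {linear X -> Y}) x
  = \sum_(t <- s) (F t : {linear X -> Y}) x.
Proof. by elim/big_rec2: _ => // t y f _ <-; rewrite -homMD. Qed.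

Lemma central_scale M (r : R) (a : L^c) (m : M) :
  (r%:A : L^c) *: (a *: m) = a *: ((r%:A : L^c) *: m).
Proof.
rewrite !scalerA; congr (_ *: _).
by change (@GRing.mul L a r%:A = @GRing.mul L r%:A a); rewrite mulr_algl mulr_algr.
Qed.

Lemma algebra_scale M (r : R) (a : L) (m : M) :
  ((r *: a : L) : L^c) *: m = (r%:A : L^c) *: ((a : L^c) *: m).
Proof.
rewrite scalerA; congr (_ *: _).
by change (r *: a = @GRing.mul L a r%:A); rewrite mulr_algr.
Qed.

Lemma alg_scaleD M (r s : R) (m : M) :
  ((r + s)%:A : L^c) *: m = (r%:A : L^c) *: m + (s%:A : L^c) *: m.
Proof. by rewrite scalerDl scalerDl. Qed.

Lemma alg_scaleM M (r s : R) (m : M) :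
  ((r * s)%:A : L^c) *: m = (r%:A : L^c) *: ((s%:A : L^c) *: m).
Proof.
by rewrite scalerA; congr (_ *: _); change ((r * s)%:A = @GRing.mul L s%:A r%:A);
  rewrite mulr_algr scalerA.
Qed.

Lemma alg_scale_linear M (r : R) : linear (fun m : M => (r%:A : L^c) *: m).
Proof. by move=> a x y; rewrite scalerDr central_scale. Qed.

(* Schur's lemma makes [R / ann S] a domain, hence a field as [R] is artinian. *)
Lemma central_inverse S (r : R) : simple_mod S ->
    (exists s : S, (r%:A : L^c) *: s <> 0) ->
  exists t : R, forall s : S, ((t * r)%:A : L^c) *: s = s.
Proof.
move=> simpS [s1 rs1].
have rI (s : S) : (r%:A : L^c) *: s = 0 -> s = 0.
  have [f fE] := linear_fun (@alg_scale_linear S r).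
  have [z|all] := simpS.2 _ (ker_pred_closed f).
    by move=> rs; apply: z; rewrite unfold_in /ker_pred fE rs.
  by have := all s1; rewrite unfold_in /ker_pred fE => /eqP.
pose c n : {pred R^o} := fun x => `[< exists y : R, (x : R) = r ^+ n * y >].
have [n|n x /asboolP[y ->]|n nP] := artinL.1 c.
- split; first by apply/asboolP; exists 0; rewrite mulr0.
  move=> a _ _ /asboolP[x ->] /asboolP[y ->]; apply/asboolP.
  by exists (a * x + y); rewrite mulrDr mulrCA.
- by apply/asboolP; exists (r * y); rewrite mulrA -exprSr.
have : (r ^+ n : R^o) \in c n by apply/asboolP; exists 1; rewrite mulr1.
rewrite -(nP n.+1 (leqnSn n)) => /asboolP[t rt].
exists t => s; apply/eqP; rewrite -subr_eq0; apply/eqP.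
have rnI m (u : S) : ((r ^+ m)%:A : L^c) *: u = 0 -> u = 0.
  elim: m => [|m IH]; first by rewrite expr0 !scale1r.
  by rewrite exprS alg_scaleM => /rI/IH.
apply: (rnI n); rewrite scalerBr -alg_scaleM {2}rt exprSr.
by rewrite [t * r]mulrC mulrA subrr.
Qed.

(** Over R this module is S. It is generated by the images of generators of the algebra, and each
    element spans a quotient of R / ann S, which is simple by [central_inverse]. *)
Lemma simple_hom_finite_length S :
  simple_mod S -> finite_length (homM (regular_mod L^c) S).
Proof.
move=> simpS; have [[s0 s0n] _] := simpS.
have pt (m : S) : exists f : {linear regular_mod L^c -> S},
    forall a : L^c, f a = a *: m.
  by apply: linear_fun => a x y; rewrite scalerDl scalerA.
have reg (f : {linear regular_mod L^c -> S}) (a : L^c) : f a = a *: f 1.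
  by rewrite -lmapZ; congr (f _); rewrite [RHS]mulr1.
pose J : {pred R^o} := fun r => `[< forall s : S, ((r : R)%:A : L^c) *: s = 0 >].
have JC : GRing.submod_closed J.
  split; first by apply/asboolP => s; rewrite !scale0r.
  move=> a x y /asboolP xJ /asboolP yJ; apply/asboolP => s.
  by rewrite alg_scaleD alg_scaleM xJ yJ scaler0 addr0.
pose k := cokM (submodule_incl JC); pose q := cokpi (submodule_incl JC).
have qJ r : q r = 0 <-> r \in J.
  by split=> [/cokpi_eq0/submodule_inclP|/(submodule_inclP JC)/cokpi_eq0].
have flk : finite_length k.
  apply: simple_finite_length; split.
    exists (q 1) => /qJ/asboolP/(_ s0); rewrite !scale1r; exact: s0n.
  move=> T [T0 TD]; have [nz|z] := pselect (exists t, t \in T /\ t <> 0); last first.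
    by left=> t tT; apply: contrapT => t0; apply: z; exists t.
  case: nz => t []; have [r <-] := cokpi_surj t => tT rJ.
  have [|u uE] := @central_inverse S r simpS.
    apply: contrapT => nr; apply: rJ; apply/qJ/asboolP => s.
    by apply: contrapT => rs; apply: nr; exists s.
  right=> y; have [x <-] := cokpi_surj y; rewrite -/q.
  have -> : q x = ((x : R) * u) *: q r + 0.
    rewrite addr0 -lmapZ; apply/eqP; rewrite -subr_eq0 -linearB; apply/eqP/qJ/asboolP=> s.
    rewrite -[((x * u) *: r)]/((x : R) * u * r : R).
    by rewrite scalerBl scalerBl -mulrA alg_scaleM uE subrr.
  exact: (TD (x * u) (q r) 0 tT T0).
apply: finite_length_of_generators.
  have [n [v vP]] := artinL.2; have [w wE] := choice (fun i => pt ((v i : L^c) *: s0)).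
  exists n, w => f; have [a as0] := simple_generated simpS s0n ((f : {linear _ -> _}) 1).
  have [c cE] := vP a; exists c; apply: homP => x.
  transitivity (\sum_(i < n) x *: (((c i)%:A : L^c) *: ((v i : L^c) *: s0))).
    rewrite (reg f x) -as0 -scaler_sumr cE; congr (_ *: _).
    apply: etrans (@scaler_suml L^c S s0 'I_n _ _ (fun i => (c i *: v i : L))) _.
    by apply: eq_bigr => i _; apply: algebra_scale.
  apply: etrans (esym (homM_sumE _ _ x)); apply: eq_bigr => i _.
  by rewrite homME wE central_scale.
move=> f.
have [|p pE] := @linear_fun R (regular_mod R) (homM (regular_mod L^c) S) (fun r : R => r *: f).
  by move=> a x y; rewrite scalerDl scalerA.
have [r|h hE] := @desc_coker _ _ _ _ (submodule_incl JC) p.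
  have /submodule_inclP/asboolP rJ :
      exists s, submodule_incl JC s = submodule_incl JC r by exists r.
  by rewrite pE; apply: homP => x; apply: rJ.
by exists k, h; split=> //; exists (q 1); rewrite hE pE scale1r.
Qed.

Lemma regular_hom_finite_length Y :
  finite_length Y -> finite_length (homM (regular_mod L^c) Y).
Proof.
elim/finite_length_ind: Y / => [Y Y0|S M N i p simpS _ _ ex IH].
  by apply: zero_finite_length => f; apply: homP => x; apply: etrans (Y0 _) (esym (Y0 _)).
apply: (@extension_finite_length _ _ _ _ (homM_map (lid (regular_mod L^c)) i)
          (homM_map (lid _) p)) => //; last exact: simple_hom_finite_length.
move=> f pf; have [||h hE] := @lift_projective _ (regular_mod L^c) _ _ i f.
- exact: projective_regular.
- move=> x; apply/ex.
  exact: (homM_apply pf x).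
by exists h; apply: homP.
Qed.

(** A cover Λ^n -> X embeds Hom(X, Y) in Hom(Λ^n, Y), which is handled by induction on n. *)
Lemma hom_finite_length X Y :
  finite_length X -> finite_length Y -> finite_length (homM X Y).
Proof.
move=> /finite_length_cover[n [p pS]] flY.
apply: (@subquotient_finite_length _ (homM (free_mod L^c n) Y) _
  (homM (free_mod L^c n) Y) (homM_map p (lid Y)) (lid _)).
- move=> f g fg; apply: homP => x; have [y <-] := pS x.
  exact: (homM_apply fg y).
- by move=> f; eexists.
elim: n {p pS} => [|n IH].
  by apply: zero_finite_length => f; apply: homP => x; rewrite (row0_eq0 x) !linear0.
pose i1 : {linear regular_mod L^c -> free_mod L^c n.+1} :=
  lpair (lid (regular_mod L^c)) (\0 : {linear _ -> free_mod L^c n}).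
pose i2 : {linear free_mod L^c n -> free_mod L^c n.+1} :=
  lpair (\0 : {linear _ -> regular_mod L^c}) (lid (free_mod L^c n)).
apply: (@sub_finite_length _ _ _
  (lpair (homM_map i1 (lid Y)) (homM_map i2 (lid Y)))); last first.
  by apply: prod_finite_length IH; apply: regular_hom_finite_length.
move=> f g e; apply: homP => -[a x].
have xE : (a, x) = i1 a + i2 x by congr (_, _); rewrite /= ?addr0 ?add0r.
rewrite xE (linearD (f : {linear _ -> _})) (linearD (g : {linear _ -> _})).
by congr (_ + _); [exact: (homM_apply (congr1 fst e) a)
  | exact: (homM_apply (congr1 snd e) x)].
Qed.

End HomFiniteLength.

Lemma lbijective (A : pzRingType) (X Y : lmodType A) (f : {linear X -> Y}) :
  injective f -> lsurjective f -> bijective f.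
Proof.
move=> fI /choice[g gE]; exists g => // x.
by apply: fI; rewrite gE.
Qed.

(** * The duality over the base ring *)

Section Dual.
Variable R : comNzRingType.
Implicit Types V W S : lmodType R.

(** The isomorphism sends r s to r s'; the inclusion of annihilators makes it well defined. *)
Lemma simple_isomorphic S S' (s : S) (s' : S') :
    simple_mod S -> simple_mod S' -> s <> 0 -> s' <> 0 ->
    (forall r : R, r *: s = 0 -> r *: s' = 0) ->
  isomorphic_mod S S'.
Proof.
move=> simpS simpS' s0 s'0 ann.
have genS := simple_generated simpS s0; have genS' := simple_generated simpS' s'0.
have [x|a _ _ _ _ [b [<- <-]] [c [<- <-]]|_ [b [/ann bs' <-]] //|f fE] :=
    @linear_relation _ S S' (fun x y => exists a : R, a *: s = x /\ a *: s' = y).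
- by have [a <-] := genS x; exists (a *: s'), a.
- by exists (a * b + c); rewrite !scalerDl !scalerA.
have fa a : f (a *: s) = a *: s'.
  have [b [bs <-]] := fE (a *: s); apply/eqP; rewrite -subr_eq0 -scalerBl.
  by apply/eqP/ann; rewrite scalerBl bs subrr.
exists f; apply: lbijective => [|y]; last first.
  by have [a <-] := genS' y; exists (a *: s).
apply: linear_inj => x fx; apply: contrapT => x0.
have [b bx] := simple_generated simpS x0 s.
by apply: s'0; rewrite -(scale1r s') -fa scale1r -bx lmapZ fx scaler0.
Qed.

(** Distinct maximal ideals are comaximal. The scalar isolates one summand in a direct sum of
    pairwise nonisomorphic simple modules. *)
Lemma simple_separation S S' : simple_mod S -> simple_mod S' ->
    ~ isomorphic_mod S S' ->
  exists r : R, (forall x : S, r *: x = 0) /\ (forall y : S', r *: y = y).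
Proof.
move=> simpS simpS' niso; have [[s s0] _] := simpS; have [[s' s'0] _] := simpS'.
have [r [rs rs']] : exists r : R, r *: s = 0 /\ r *: s' <> 0.
  apply: contrapT => nr; apply: niso.
  apply: (simple_isomorphic (s := s) (s' := s')) => // r rs.
  by apply: contrapT => rs'; apply: nr; exists r.
have [b brs'] := simple_generated simpS' rs' s'.
exists (b * r); split=> [x|y].
  have [a <-] := simple_generated simpS s0 x.
  by rewrite scalerA mulrC mulrA -scalerA rs scaler0.
have [a <-] := simple_generated simpS' s'0 y.
by rewrite scalerA mulrC -scalerA -scalerA brs'.
Qed.

Variable I : lmodType R.
Hypothesis envI : envelope_of_simples I.

Definition dualM V : lmodType R := dualR I V.
Definition dualM_map V W (f : {linear V -> W}) : {linear dualM W -> dualM V} :=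
  dualR_map I f.

Lemma envelope_injective : injective_mod I.
Proof. by case: envI => J [S [B [u [e [_ _ []]]]]]. Qed.

(** Evaluation at a nonzero [s] embeds D S in I. Its values lie in the copy of [T j], the
    representative of S: essentiality puts them in e(B), and scalars acting as 1 on [T j] cut out
    that summand. *)
Lemma simple_dual_finite_length S : simple_mod S -> finite_length (dualM S).
Proof.
move=> simpS.
have [J [T [B [u [e [[simpT isoT repT] sumB [eI _ ess]]]]]]] := envI.
have [j [phi phiB]] := repT S simpS.
have [[s s0] _] := simpS.
have [ev evE] : exists f : {linear dualM S -> I},
    forall l, f l = (l : {linear S -> I}) s by apply: linear_fun.
have flT : finite_length (T j) by apply: simple_finite_length.
apply: (subquotient_finite_length (f := ev) (p := lcomp e (u j))) => //.
  apply: linear_inj => l; rewrite evE => ls; apply: homP => x.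
  have [a <-] := simple_generated simpS s0 x.
  by rewrite lmapZ ls scaler0.
move=> l; rewrite evE.
have lE a y : (l : {linear S -> I}) (a *: y) = a *: (l : {linear S -> I}) y := lmapZ _ a y.
pose Q : {pred B} := fun b => `[< exists r : R, (forall y : T j, r *: y = y) /\
  exists t, u j t = r *: b >].
have QC : GRing.submod_closed Q.
  split.
    apply/asboolP; exists 1; split=> [y|]; first by rewrite scale1r.
    by exists 0; rewrite linear0 scaler0.
  move=> a x y /asboolP[r [rT [t tE]]] /asboolP[r' [rT' [t' tE']]].
  apply/asboolP; exists (r * r'); split=> [z|]; first by rewrite -scalerA rT' rT.
  exists (a *: (r' *: t) + r *: t'); rewrite linearP !(lmapZ (u j)) tE tE'.
  by rewrite scalerDr !scalerA; congr (_ *: _ + _); ring.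
(* The direct sum is known by its universal property only: B -> B / Q vanishes on every summand,
   hence equals 0. *)
have QB b : b \in Q.
  have [h [_ hU]] := sumB _ (fun j => \0 : {linear T j -> cokM (submodule_incl QC)}).
  apply/(submodule_inclP QC)/cokpi_eq0.
  rewrite (hU (cokpi (submodule_incl QC))) => [|k x]; first by rewrite -(hU \0).
  apply/cokpi_eq0/submodule_inclP/asboolP.
  have [kj|kj] := pselect (k = j).
    exists 1; split=> [y|]; first by rewrite scale1r.
    by move: x; rewrite kj => x; exists x; rewrite scale1r.
  have [|r [rk rj]] := simple_separation (simpT k) (simpT j); first by move=> /isoT.
  by exists r; split=> //; exists 0; rewrite linear0 -lmapZ rk linear0.
have [ls|ls] := pselect ((l : {linear S -> I}) s = 0); first by exists 0; rewrite linear0 ls.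
set x := (l : {linear S -> I}) s in ls *.
have [||b [/asboolP[r rx] eb0]] := ess (fun y => `[< exists r : R, r *: x = y >]).
- split; first by apply/asboolP; exists 0; rewrite scale0r.
  move=> a _ _ /asboolP[y <-] /asboolP[z <-]; apply/asboolP.
  by exists (a * y + z); rewrite scalerDl scalerA.
- by exists x; split=> //; apply/asboolP; exists 1; rewrite scale1r.
(* By simplicity of S, x is a multiple of r x, so x itself lies in e(B). *)
have rs0 : r *: s <> 0 by move=> rs; apply: eb0; rewrite -rx -lE rs linear0.
have [t trs] := simple_generated simpS rs0 s.
have xE : e (t *: b) = x by rewrite lmapZ -rx scalerA -lE -scalerA trs.
(* As q - 1 kills [T j], it kills S and therefore x; so x = q x = e (u j w). *)
have /asboolP[q [qT [w wE]]] := QB (t *: b).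
exists w; rewrite /= wE -xE -[in RHS](scale1r (t *: b)); apply/eqP.
rewrite -subr_eq0 -linearB -scalerBl lmapZ xE -lE.
apply/eqP; rewrite (_ : _ *: s = 0) ?linear0 //.
by apply: (bij_inj phiB); rewrite lmapZ linear0 scalerBl scale1r qT subrr.
Qed.

Lemma dual_finite_length V : finite_length V -> finite_length (dualM V).
Proof.
elim/finite_length_ind: V / => [V V0|S V W i p simpS _ pS ex IH].
  by apply: zero_finite_length => f; apply: homP => x; rewrite (V0 x) !linear0.
apply: (@extension_finite_length _ _ _ _ (dualM_map p) (dualM_map i)) => //.
  move=> l il; have [x /ex[s <-]|h hE] := desc_surjective (g := (l : {linear V -> I})) pS.
    exact: (congr1 (fun g : dualM _ => (g : {linear _ -> _}) s) il).
  by exists h; apply: homP.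
exact: simple_dual_finite_length.
Qed.

Lemma dual_nonzero V : finite_length V -> (exists v : V, v <> 0) ->
  exists (l : {linear V -> I}) v, l v <> 0.
Proof.
move=> flV V0; have [S [i [simpS iI]]] := simple_submodule flV V0.
have [J [T [B [u [e [[simpT isoT repT] sumB [eI injI _]]]]]]] := envI.
have [j [phi phiB]] := repT S simpS; have [[s s0] _] := simpS.
(* Components of the projection of B onto [T j], which shows that [u j] is injective; the cast
   carries the identity along k = j. *)
pose g k : {linear T k -> T j} :=
  if pselect (k = j) is left kj then ecast k {linear T k -> T j} (esym kj) (lid _) else \0.
have [h [hE _]] := sumB _ g.
have [l lE] := injI _ _ i (lcomp e (lcomp (u j) phi)) iI.
exists l, (i s); rewrite lE /= -(linear0 e) => /eI us.
apply: s0; apply: (bij_inj phiB); rewrite linear0 -(linear0 h) -us hE /g.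
by case: pselect => // e'; rewrite (Prop_irrelevance e' erefl).
Qed.

End Dual.

(** * The Nakayama functor D Hom(-, L) *)

Section Nakayama.
Variables (R : comNzRingType) (L : algType R) (I : lmodType R).
Implicit Types P Y X : lmodType L^c.
Implicit Types T : lmodType L.

Definition starM P : lmodType L := star P.
Definition dualLM T : lmodType L^c := dualL I T.

Lemma rank1_linear P Y (y : Y) (xi : starM P) :
  linear (fun p : P => ((xi : {linear P -> regular_mod L^c}) p : L^c) *: y).
Proof. by move=> a p q; rewrite linearP scalerDl scalerA. Qed.

(* the image of y ⊗ xi under Y ⊗ P^* -> Hom(P, Y) *)
Definition rank1 P Y (y : Y) (xi : starM P) : homM P Y :=
  sval (cid (linear_fun (rank1_linear y xi))).

Lemma rank1E P Y (y : Y) (xi : starM P) p :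
  (rank1 y xi : {linear P -> Y}) p
  = ((xi : {linear P -> regular_mod L^c}) p : L^c) *: y.
Proof. exact: (svalP (cid (linear_fun (rank1_linear y xi)))). Qed.

Lemma rank1_linearl P Y (xi : starM P) (a : L^c) (y y' : Y) :
  rank1 (a *: y + y') xi = rank1 y ((a : L) *: xi) + rank1 y' xi.
Proof.
apply: homP => p; rewrite homMD !rank1E scalerDr scalerA; congr (_ + _).
Qed.

Lemma rank1_linearr P Y (y : Y) (r : R) (xi xi' : starM P) :
  rank1 y ((r%:A : L) *: xi + xi') = r *: rank1 y xi + rank1 y xi'.
Proof.
apply: homP => p; rewrite homMD homME !rank1E scalerA -scalerDl; congr (_ *: _).
rewrite [LHS]/=.
change (@GRing.mul L r%:A ((xi : {linear _ -> _}) p) + (xi' : {linear _ -> _}) p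
 = @GRing.mul L ((xi : {linear _ -> _}) p) r%:A + (xi' : {linear _ -> _}) p).
by rewrite mulr_algl mulr_algr.
Qed.

Lemma rank1_comp P P' Y Y' (u : {linear P' -> P}) (v : {linear Y -> Y'})
    (y : Y) (xi : starM P) :
  homM_map u v (rank1 y xi) = rank1 (v y) (star_map u xi).
Proof. by apply: homP => p; rewrite rank1E /= rank1E lmapZ. Qed.

Lemma dualLM_scale T (f : dualLM T) (a : L^c) t :
  ((a *: f : dualLM T) : {linear res T -> I}) t
  = (f : {linear res T -> I}) ((a : L) *: (t : T)).
Proof. by []. Qed.

Lemma dualLM_add T (f f' : dualLM T) t :
  ((f + f' : dualLM T) : {linear res T -> I}) t
  = (f : {linear res T -> I}) t + (f' : {linear res T -> I}) t.
Proof. by []. Qed.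

Lemma dualLM_linear T (f : dualLM T) (r : R) (t t' : T) :
  (f : {linear res T -> I}) ((r%:A : L) *: t + t')
  = r *: (f : {linear res T -> I}) t + (f : {linear res T -> I}) t'.
Proof. by rewrite -linearP. Qed.

(** The adjunction Hom(Y ⊗ T, I) = Hom(Y, D T), with a balanced map in place of a functional on the
    tensor product. *)
Lemma linear_to_dual Y T (b : Y -> T -> I) :
    (forall y r t t', b y ((r%:A : L) *: t + t') = r *: b y t + b y t') ->
    (forall (a : L^c) y y' t, b (a *: y + y') t = b y ((a : L) *: t) + b y' t) ->
  exists g : {linear Y -> dualLM T},
    forall y t, (g y : {linear res T -> I}) t = b y t.
Proof.
move=> bR bL.
have gy y : exists f : {linear res T -> I}, forall t, f t = b y t.
  by apply: linear_fun => r t t'; apply: bR.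
have [g gE] := choice gy.
have [|h hE] := @linear_fun _ Y (dualLM T) g.
  move=> a y y'; apply: homP => t.
  by rewrite [LHS]gE bL -!gE.
by exists h => y t; rewrite hE gE.
Qed.

Variables (P : lmodType L^c) (T : lmodType L) (pi : {linear starM P -> T}).

(** On maps of rank one, [mu] is a balanced map of pairs (y, xi); the hypothesis lets it descend
    along [pi] to pairs in Y and T. *)
Lemma linear_to_dual_of_functional Y (mu : {linear homM P Y -> I}) :
    lsurjective pi ->
    (forall y xi, pi xi = 0 -> mu (rank1 y xi) = 0) ->
  exists g : {linear Y -> dualLM T},
    forall y xi, (g y : {linear res T -> I}) (pi xi) = mu (rank1 y xi).
Proof.
move=> piS mu0; have [s sE] := choice piS.
have muE y xi xi' : pi xi = pi xi' -> mu (rank1 y xi) = mu (rank1 y xi').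
  move=> e; apply/eqP; rewrite -subr_eq0 -linearB.
  have -> : rank1 y xi - rank1 y xi' = rank1 y ((((-1)%:A : L) *: xi') + xi).
    by rewrite rank1_linearr scaleN1r addrC.
  by apply/eqP/mu0; rewrite !scaleN1r addrC linearB e subrr.
have [||g gE] := @linear_to_dual Y T (fun y t => mu (rank1 y (s t))).
- move=> y r t t'; rewrite -linearP -rank1_linearr; apply: muE.
  by rewrite linearP !sE.
- move=> a y y' t; rewrite rank1_linearl linearD; congr (_ + _).
  by apply: muE; rewrite lmapZ !sE.
by exists g => y xi; rewrite gE; apply: muE.
Qed.

Hypothesis dbP : has_dual_basis P.

(** The dual basis writes f as the sum of [rank1 (f t.1) t.2], which dictates the formula for
    [mu]. *)
Lemma functional_of_linear_to_dual Y (g : {linear Y -> dualLM T}) :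
  exists mu : {linear homM P Y -> I},
    forall y xi, mu (rank1 y xi) = (g y : {linear res T -> I}) (pi xi).
Proof.
have [s sE] := dbP.
have [|mu muE] := @linear_fun R (homM P Y) I (fun f => \sum_(t <- s)
   (g ((f : {linear P -> Y}) t.1) : {linear res T -> I}) (pi (t.2 : starM P))).
  move=> r f f'; rewrite scaler_sumr -big_split; apply: eq_bigr => t _ /=.
  have -> : homR_scale_fun r f t.1 + (f' : {linear P -> Y}) t.1
    = (r%:A : L^c) *: (f : {linear P -> Y}) t.1 + (f' : {linear P -> Y}) t.1 by [].
  rewrite linearP; set F := g _; set F' := g _.
  apply: (@etrans _ _ ((F : {linear res T -> I}) ((r%:A : L) *: pi t.2)
    + (F' : {linear res T -> I}) (pi t.2))); first by [].
  by rewrite -[_ *: pi _]addr0 dualLM_linear linear0 addr0.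
exists mu => y xi; rewrite muE.
transitivity ((g y : {linear res T -> I})
  (pi (\sum_(t <- s) ((xi : {linear P -> regular_mod L^c}) t.1 : L) *: (t.2 : starM P)))).
  rewrite lmap_sum.
  have dual_sum (f : {linear res T -> I}) r (F : _ -> T) :
      f (\sum_(t <- r) F t : T) = \sum_(t <- r) f (F t) by exact: linear_sum.
  rewrite dual_sum; apply: eq_bigr => t _; rewrite rank1E lmapZ dualLM_scale.
  by rewrite lmapZ.
congr (_ (pi _)); apply: homP => p.
have star_sum r (F : _ -> starM P) :
    ((\sum_(t <- r) F t : starM P) : {linear P -> regular_mod L^c}) p
    = \sum_(t <- r) (F t : {linear P -> regular_mod L^c}) p.
  by elim/big_rec2: _ => // t a f _ <-.
by rewrite star_sum {2}(sE p) lmap_sum; apply: eq_bigr => t _; rewrite lmapZ.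
Qed.

(** Hence a functional on Hom(P, Y) is determined by its values on maps of rank one. *)
Lemma rank1_span Y (f : homM P Y) : exists s : seq (Y * starM P),
  f = \sum_(t <- s) rank1 t.1 t.2.
Proof.
have [s sE] := dbP.
exists [seq ((f : {linear P -> Y}) t.1, (t.2 : starM P)) | t <- s].
rewrite big_map; apply: homP => p; rewrite homM_sumE {1}(sE p) lmap_sum.
by apply: eq_bigr => t _; rewrite lmapZ rank1E.
Qed.

End Nakayama.

(** * Projectives and injectives in a cluster-tilting subcategory *)

Section ExtVanishing.
Variable A : pzRingType.
Implicit Types X Y : lmodType A.

Lemma Ext_injective k X Y : injective_mod Y -> Ext_succ_eq0 k X Y.
Proof.
move=> injY P f fd; apply: ext_injective injY _ => x.
by move=> /res_exact[y <-]; apply: fd.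
Qed.

Lemma Ext_projective k X Y : projective_mod X -> Ext_succ_eq0 k X Y.
Proof.
move=> projX P f fd.
(* A resolution of a projective module splits: the next homotopy lifts id - h d, whose image
   consists of cycles. *)
have [h hE] : exists h : {linear P k -> P k.+1},
    forall x, res_dif P k (h (res_dif P k x)) = res_dif P k x.
  elim: k {f fd} => [|k [h hE]].
    have [s sE] := projX _ _ (res_aug P) (lid X) (@res_aug_surj _ _ P).
    have [x|h hE] := @lift_projective _ _ _ _ (res_dif P 0) (lid _ \- lcomp s (res_aug P))
        (@res_projective _ _ P 0).
      by apply/res_exact0; rewrite /= linearB sE subrr.
    have augd x : res_aug P (res_dif P 0 x) = 0 by apply/res_exact0; exists x.
    by exists h => x; rewrite hE /= augd linear0 subr0.
  have [x|h' h'E] := @lift_projective _ _ _ _ (res_dif P k.+1)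
      (lid _ \- lcomp h (res_dif P k)) (@res_projective _ _ P k.+1).
    by apply/res_exact; rewrite /= linearB hE subrr.
  have dd x : res_dif P k (res_dif P k.+1 x) = 0 by apply/res_exact; exists x.
  by exists h' => x; rewrite h'E /= dd linear0 subr0.
exists (lcomp f h) => x; apply/eqP; rewrite -subr_eq0 /= -linearB; apply/eqP.
have /res_exact[y <-] : res_dif P k (h (res_dif P k x) - x) = 0.
  by rewrite linearB hE subrr.
exact: fd.
Qed.

Variables (d : nat) (C : modfl A -> Prop).
Hypothesis ctC : cluster_tilting d C.

Lemma ct_projective (X : modfl A) : projective_mod X -> C X.
Proof. by move=> pX; apply/(ct_left ctC) => k _ Y _; apply: Ext_projective. Qed.

Lemma ct_injective (Y : modfl A) : injective_mod Y -> C Y.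
Proof. by move=> iY; apply/(ct_right ctC) => k _ X _; apply: Ext_injective. Qed.

End ExtVanishing.

(** * The injective cogenerator and exactness at the last term *)

Section NakayamaInjective.
Variables (R : comNzRingType) (L : algType R) (I : lmodType R).
Implicit Types P Y X : lmodType L^c.

(** Maps M -> D P^* are functionals on Hom(P, M), and these extend along the injection Hom(P, M) ->
    Hom(P, N) because I is injective. *)
Lemma dual_star_injective P :
  has_dual_basis P -> injective_mod I -> injective_mod (dualLM I (starM P)).
Proof.
move=> dbP injI M N g f gI.
have [mu muE] := functional_of_linear_to_dual (lid (starM P)) dbP f.
have [phi|nu nuE] := @ext_injective _ _ _ _ (homM_map (lid P) g) mu injI.
  move=> gphi; rewrite (_ : phi = 0) ?linear0 //; apply: homP => x.
  by apply: gI; rewrite [RHS]linear0; apply: (homM_apply gphi x).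
have [||h hE] := @linear_to_dual_of_functional _ _ I P _ (lid (starM P)) N nu.
- by move=> xi; exists xi.
- move=> y xi /= ->; rewrite (_ : rank1 y 0 = 0) ?linear0 //.
  by apply: homP => p; rewrite rank1E scale0r.
exists h => m; apply: homP => xi.
apply: etrans (hE (g m) xi) _; apply: etrans (muE m xi); rewrite -nuE rank1_comp.
by congr (nu (rank1 _ _)); apply: homP.
Qed.

(** R acts through the algebra, so a chain of submodules over the algebra is also one over R. *)
Lemma dualL_finite_length (T : lmodType L) :
  finite_length (dualM I (res T : lmodType R)) -> finite_length (dualLM I T).
Proof.
move=> [l Dl]; exists l => n c [cS cI]; apply: (Dl n c); split=> // i /cS[c0 cD].
split=> // r f g fc gc.
have -> : (r *: f + g) = ((r%:A : L^c) *: (f : dualLM I T) + (g : dualLM I T)).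
  apply: homP => t.
  apply: (@etrans _ _ ((f : {linear res T -> I}) ((r%:A : L) *: (t : T))
    + (g : {linear res T -> I}) t)); last by [].
  have -> : ((r%:A : L) *: (t : T)) = (r *: (t : res T)) by [].
  by rewrite (lmapZ (f : {linear res T -> I})).
exact: cD.
Qed.

Hypothesis artinL : artin_algebra L.
Hypothesis envI : envelope_of_simples I.
Hypothesis pres : forall X : modfl L^c, presentation X.

Lemma algebra_finite_length : finite_length (regular_mod L^c).
Proof.
apply: regular_finite_length => X; exists (pres0 (pres X)), (pres_aug (pres X)).
split; last exact: pres_aug_surj.
by split; [apply: modflP | apply: pres0_projective].
Qed.

(** This is D(Λ), with the left module Λ written as the star of the right regular module so that
    [dual_star_injective] applies. *)
Definition cogen : lmodType L^c := dualLM I (starM (regular_mod L^c)).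

Lemma cogen_finite_length : finite_length cogen.
Proof.
apply: dualL_finite_length; apply: dual_finite_length => //.
have flL := algebra_finite_length.
(* The identity map: R acts by right multiplication on the source and by left multiplication on the
   target, and these agree since R is central. *)
have [|f fE] := @linear_fun R (homM (regular_mod L^c) (regular_mod L^c))
    (res (starM (regular_mod L^c)) : lmodType R) (fun f => f).
  move=> r f g; apply: homP => x.
  congr (_ + _).
  change (@GRing.mul L ((f : {linear regular_mod L^c -> regular_mod L^c}) x) r%:A =
          @GRing.mul L r%:A ((f : {linear regular_mod L^c -> regular_mod L^c}) x)).
  by rewrite mulr_algl mulr_algr.
apply: (quotient_finite_length (p := f)); first by move=> g; exists g; rewrite fE.
exact: hom_finite_length.
Qed.

Lemma cogen_injective : injective_mod cogen.
Proof.
apply: dual_star_injective; last exact: envelope_injective envI.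
exact: (@projective_dual_basis _ (regular_mod L^c) (@projective_regular _) algebra_finite_length).
Qed.

(** Maps Y -> D(Λ) are functionals on Hom(Λ, Y) = Y, and a nonzero module of finite length has a
    nonzero functional. *)
Lemma cogenP Y : finite_length Y -> (exists y : Y, y <> 0) ->
  exists (g : {linear Y -> cogen}) y, g y <> 0.
Proof.
move=> flY [y y0].
have [pt ptE] : exists f : {linear regular_mod L^c -> Y},
    forall a : L^c, f a = a *: y.
  by apply: linear_fun => a b c; rewrite scalerDl scalerA.
have [||l [w lw]] := @dual_nonzero R I envI (homM (regular_mod L^c) Y).
- exact: regular_hom_finite_length.
- exists (pt : homM _ _) => /homM_apply/(_ 1).
  by rewrite ptE scale1r; apply: y0.
have [||g gE] := @linear_to_dual_of_functional _ _ I _ _ (lid (starM (regular_mod L^c))) Y l.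
- by move=> xi; exists xi.
- move=> z xi /= ->; rewrite (_ : rank1 z 0 = 0) ?linear0 //.
  by apply: homP => p; rewrite rank1E scale0r.
pose one := lid (regular_mod L^c) : starM (regular_mod L^c).
exists g, ((w : {linear regular_mod L^c -> Y}) 1) => g0; apply: lw.
have := gE ((w : {linear regular_mod L^c -> Y}) 1) one; rewrite g0 => /esym.
rewrite (_ : rank1 _ _ = w) //; apply: homP => a; rewrite rank1E -lmapZ.
by congr ((w : {linear _ -> _}) _); rewrite [LHS]mulr1.
Qed.

Variables (d : nat) (C : modfl L^c -> Prop).
Hypothesis ctC : cluster_tilting d C.

Lemma dexact_surjective (D : dexact C d) : lsurjective (dx_dif D d).
Proof.
move=> y; apply: contrapT => ny.
have flQ : finite_length (cokM (dx_dif D d)).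
  by apply: (quotient_finite_length (p := cokpi _)); [apply: cokpi_surj | apply: modflP].
have [|g [q gq]] := cogenP flQ.
  by exists (cokpi (dx_dif D d) y) => /cokpi_eq0.
have [x qx] := cokpi_surj q; apply: gq; rewrite -qx.
have CQ : C (ModFL cogen_finite_length).
  by apply: (ct_injective ctC); apply: cogen_injective.
apply: (dx_co_mono CQ (g := lcomp g (cokpi (dx_dif D d)))).
move=> z; rewrite /= (_ : cokpi _ _ = 0) ?linear0 //.
by apply/cokpi_eq0; exists z.
Qed.

End NakayamaInjective.

(** * Lifting along resolutions *)

Section Syzygies.
Variables (A : pzRingType) (pres : forall X : modfl A, presentation X).
Implicit Types X Y : modfl A.

Definition syz X i : modfl A := fiter i (Omega pres) X.
Definition syz_map X Y (u : {linear X -> Y}) i : {linear syz X i -> syz Y i} :=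
  fmor (fiter i (Omega pres)) (u : @Mor (pstab_mod A) X Y).
Definition pr X i : modfl A := pres0 (pres (syz X i)).
Definition aug X i : {linear pr X i -> syz X i} := pres_aug (pres (syz X i)).

Lemma dif_subproof X i : exists f : {linear pr X i.+1 -> pr X i},
  forall p, f p = ker_incl (aug X i) (aug X i.+1 p).
Proof. by exists (lcomp (ker_incl (aug X i)) (aug X i.+1)). Qed.

(** Sealed by [cid], so that the composite through the syzygy is unfolded by [difE] alone. *)
Definition dif X i : {linear pr X i.+1 -> pr X i} := sval (cid (dif_subproof X i)).

Lemma difE X i p : dif X i p = ker_incl (aug X i) (aug X i.+1 p).
Proof. exact: (svalP (cid (dif_subproof X i))). Qed.

Definition pr_map X Y (u : {linear X -> Y}) i : {linear pr X i -> pr Y i} :=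
  Defs.lift0 pres (syz_map u i).

Lemma pr_projective X i : projective_mod (pr X i).
Proof. exact: pres0_projective. Qed.

Lemma aug_surj X i : lsurjective (aug X i).
Proof. exact: pres_aug_surj. Qed.

Lemma dif_eq0 X i p : dif X i p = 0 <-> aug X i.+1 p = 0.
Proof. by rewrite difE; split=> [dp|->]; [apply: val_inj | rewrite linear0]. Qed.

Lemma aug_eq0 X i p : aug X i p = 0 <-> exists q, dif X i q = p.
Proof.
split=> [pK|[q <-]]; last by rewrite difE; apply: ker_inclK.
have pK' : p \in ker_pred (aug X i) by apply/eqP.
by have [q qE] := @aug_surj X i.+1 (Ker pK'); exists q; rewrite difE qE.
Qed.

Lemma aug_dif X i q : aug X i (dif X i q) = 0.
Proof. by apply/aug_eq0; exists q. Qed.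

Definition syz_resolution X : projective_resolution X.
Proof.
apply: (@ProjectiveResolution A X (fun i => pr X i) (dif X) (aug X 0)).
- exact: pr_projective.
- exact: (@aug_surj X 0).
- exact: (@aug_eq0 X 0).
- by move=> n y; apply: iff_trans (dif_eq0 y) (aug_eq0 y).
Defined.

Lemma syz_Ext X (Y : lmodType A) i : Ext_succ_eq0 i X Y ->
  forall f : {linear pr X i.+1 -> Y}, (forall p, aug X i.+1 p = 0 -> f p = 0) ->
  exists g : {linear pr X i -> Y}, forall p, g (dif X i p) = f p.
Proof.
move=> E f f0; apply: (E (syz_resolution X) f) => p.
exact/f0/aug_dif.
Qed.

Lemma aug_map X Y (u : {linear X -> Y}) i p :
  aug Y i (pr_map u i p) = syz_map u i (aug X i p).
Proof. exact: Defs.lift0E. Qed.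

Lemma dif_map X Y (u : {linear X -> Y}) i p :
  dif Y i (pr_map u i.+1 p) = pr_map u i (dif X i p).
Proof. by rewrite !difE aug_map. Qed.

End Syzygies.

(** * Lifting along a d-exact sequence *)

Section Staircase.
Variables (R : comNzRingType) (L : algType R).
Variables (pres : forall X : modfl L^c, presentation X).
Variables (e : nat) (C : modfl L^c -> Prop).
Hypothesis ctC : cluster_tilting e.+1 C.

Local Notation pr := (pr pres).
Local Notation aug := (aug pres).
Local Notation dif := (dif pres).

Section Fixed.
Variables (D : dexact C e.+1) (X : modfl L^c).
Local Notation x := (dx_dif D).

(* [stair g i j f]: g : X -> D e.+2 lifts to maps pr X k -> D (i + j - k), k <= i,
   compatible with the differentials, and f is the last of them.  The equality of tagged elements spares a cast between D j.+1
   and D e.+2. *)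
Fixpoint stair (g : {linear X -> D e.+2}) i :
    forall j, {linear pr X i -> D j} -> Prop :=
  match i with
  | 0%N => fun j f => forall p,
      Tagged (fun k => (D k : Type)) (x j (f p))
      = Tagged (fun k => (D k : Type)) (g (aug X 0 p))
  | i'.+1 => fun j f' => exists f : {linear pr X i' -> D j.+1},
      (forall p, x j (f' p) = f (dif X i' p)) /\ stair g f
  end.

Lemma stair_index g i j f : @stair g i j f -> (i + j = e.+1)%N.
Proof.
elim: i j f => [|i IH] j f; first by move=> /(_ 0)/(congr1 tag) /= [].
by case=> f' [_ /IH]; rewrite addnS.
Qed.

Lemma stair0E g (f : {linear pr X 0 -> D e.+1}) :
  @stair g 0 e.+1 f <-> forall p, x e.+1 (f p) = g (aug X 0 p).
Proof. by split=> gf p; have := gf p; [apply: eq_from_Tagged | move=> ->]. Qed.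

Lemma stair_linear (r : R) (g1 g2 : homM X (D e.+2)) i j
    (f1 f2 : homM (pr X i) (D j)) :
  stair g1 f1 -> stair g2 f2 ->
  stair (r *: g1 + g2 : homM X (D e.+2)) (r *: f1 + f2 : homM (pr X i) (D j)).
Proof.
elim: i j f1 f2 => [|i IH] j f1 f2.
  move=> s1; have ij := stair_index s1; rewrite add0n in ij; subst j.
  move=> s2; apply/(stair0E (_ : homM _ _) (_ : homM _ _)) => p.
  by rewrite !homMD !homME linearD lmapZ ((stair0E g1 f1).1 s1) ((stair0E g2 f2).1 s2).
case=> h1 [e1 s1] [h2 [e2 s2]].
exists (r *: (h1 : homM _ _) + (h2 : homM _ _) : homM (pr X i) (D j.+1)).
split; last exact: IH.
by move=> p; rewrite !homMD !homME linearD lmapZ e1 e2.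
Qed.

Lemma stair_zero i j : (i + j = e.+1)%N ->
  @stair \0 i j \0.
Proof.
elim: i j => [|i IH] j; first by rewrite add0n => -> p; rewrite linear0.
rewrite addSnnS => /IH s; exists \0; split=> // p.
by rewrite /= linear0.
Qed.

Hypothesis CX : C X.
Hypothesis surjD : lsurjective (x e.+1).

Let lift_pr i j (f : {linear pr X i -> D j.+1}) : (j < e.+1)%N ->
  (forall p, x j.+1 (f p) = 0) ->
  exists h : {linear pr X i -> D j}, forall p, x j (h p) = f p.
Proof.
move=> je; apply: (dx_contra_exact _ je).
by apply: (ct_projective ctC); apply: pr_projective.
Qed.

Lemma stair_cycle g i j (f : {linear pr X i -> D j}) : stair g f ->
  forall p, aug X i p = 0 -> x j (f p) = 0.
Proof.
case: i f => [|i] f sf p ap.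
  have ij := stair_index sf; rewrite add0n in ij; subst j.
  by rewrite ((stair0E _ _).1 sf) ap linear0.
by case: sf => f' [-> _]; rewrite (_ : dif X i p = 0) ?linear0 //; apply/dif_eq0.
Qed.

(** The comparison theorem: the first lift uses surjectivity onto the last term, the others
    exactness of Hom(P, -) on delta, valid because projectives belong to C. *)
Lemma stair_total g i j : (i + j = e.+1)%N -> exists f, @stair g i j f.
Proof.
elim: i j => [|i IH] j ij.
  rewrite add0n in ij; subst j.
  have [p|f fE] := lift_projective (f := x e.+1) (a := lcomp g (aug X 0))
    (@pr_projective _ pres X 0).
    exact: surjD.
  by exists f; apply/stair0E.
have [f sf] := IH j.+1 (etrans (esym (addSnnS i j)) ij).
have [||h hE] := @lift_pr i.+1 j (lcomp f (dif X i)).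
- by rewrite -ij addSn ltnS leq_addl.
- by move=> p; apply: (stair_cycle sf); apply: aug_dif.
by exists h; exists f.
Qed.

(** The map [h] is one component of a null-homotopy, moved one degree per induction step. Lowering
    the degree of the target lifts [f] minus [h] after [dif] along delta; the way back rests on
    Ext^(i+1)(X, D j.+1) = 0. *)
Lemma stair_factor g i j (f : {linear pr X i -> D j.+1}) : @stair g i j.+1 f ->
  (exists k : {linear X -> D e.+1}, forall y, x e.+1 (k y) = g y) <->
  (exists h : {linear pr X i -> D j}, forall p, aug X i p = 0 -> f p = x j (h p)).
Proof.
elim: i j f => [|i IH] j f.
  move=> s; have ij := stair_index s; rewrite add0n in ij; case: ij => ij; subst j.
  move/stair0E: s => s; split=> [[k kE]|[h hE]].
    have [||h hE] := @lift_pr 0 e (f \- lcomp k (aug X 0)); first by [].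
      by move=> p; rewrite /= linearB s kE subrr.
    by exists h => p ap; rewrite hE /= ap linear0 subr0.
  have [p ap|k kE] := desc_surjective (g := f \- lcomp (x e) h) (@aug_surj _ pres X 0).
    by rewrite /= hE // subrr.
  exists k => y; have [p <-] := @aug_surj _ pres X 0 y.
  by rewrite kE /= linearB s dx_complex subr0.
case=> f' [fE sf']; have je : (j < e.+1)%N.
  by rewrite -(stair_index sf') addnS ltnS; apply: leq_trans (leq_addl i _).
apply: (iff_trans (IH _ _ sf')); split=> [[h hE]|[h hE]].
  have [p|h' h'E] := @lift_pr i.+1 j (f \- lcomp h (dif X i)) je.
    by rewrite /= linearB fE hE ?subrr //; apply: aug_dif.
  by exists h' => p /dif_eq0 dp; rewrite h'E /= dp linear0 subr0.
(* The degree i + 1 is at most d - 1 = e, since i + j + 2 = e + 1. *)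
have [||h' h'E] := @syz_Ext _ pres X (D j.+1) i _ (f \- lcomp (x j) h).
- apply: (ct_left ctC X).1 => //; last by apply: dx_in; rewrite ltnS; apply: ltnW.
  by rewrite -(stair_index sf') !addnS !ltnS leq_addr.
- by move=> p ap; rewrite /= hE // subrr.
by exists h' => p /aug_eq0[q <-]; rewrite h'E /= linearB fE dx_complex subr0.
Qed.

(** Vanishing of Ext^(i+1)(X, -) extends the composite of [f] with the differential of delta along
    [dif], one step back towards X at a time. *)
Lemma stair_onto i j (f : {linear pr X i -> D j.+1}) : (i + j.+1 = e.+1)%N ->
    (forall p, aug X i p = 0 -> x j.+1 (f p) = 0) ->
  exists g, stair g f.
Proof.
elim: i j f => [|i IH] j f ij f0.
  rewrite add0n in ij; case: ij => ij; subst j.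
  have [p ap|g gE] := desc_surjective (g := lcomp (x e.+1) f) (@aug_surj _ pres X 0).
    exact: f0.
  by exists g; apply/stair0E => p; rewrite gE.
have [||h hE] := @syz_Ext _ pres X (D j.+2) i _ (lcomp (x j.+1) f).
- apply: (ct_left ctC X).1 => //; last by apply: dx_in; rewrite -ij ltnS leq_addl.
  by rewrite -ij addSn addnS !ltnS leq_addr.
- by move=> p /f0.
have [||g sg] := IH j.+1 h; first by rewrite addnS -addSn.
  by move=> p /aug_eq0[q <-]; rewrite hE /= dx_complex.
by exists g; exists h; split=> [p|//]; rewrite hE.
Qed.

End Fixed.

(** The lifts [pr_map] commute strictly with the differentials, so lifts compose to lifts. *)
Lemma stair_map (D E : dexact C e.+1) (X Y : modfl L^c) (c : chain_map D E)
    (u : {linear X -> Y}) (g : {linear Y -> D e.+2}) i j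
    (f : {linear pr Y i -> D j}) : stair g f ->
  stair (lcomp (c e.+2) (lcomp g u)) (lcomp (c j) (lcomp f (pr_map pres u i))).
Proof.
elim: i j f => [|i IH] j f.
  move=> s; have ij := stair_index s; rewrite add0n in ij; subst j.
  move/stair0E: s => s; apply/stair0E => p.
  by rewrite /= -cm_comm s aug_map.
case=> f' [fE sf']; exists (lcomp (c j.+1) (lcomp f' (pr_map pres u i))).
split=> [p|]; last exact: IH.
by rewrite /= -cm_comm fE -dif_map.
Qed.

End Staircase.

Section Relation.
Variables (R : comNzRingType) (L : algType R).
Variables (pres : forall X : modfl L^c, presentation X).
Variables (e : nat) (C : modfl L^c -> Prop).
Hypothesis ctC : cluster_tilting e.+1 C.

Implicit Types X Y : modfl L^c.

(** P_d is the second term of the presentation of the last syzygy, not [pr pres X e.+1], because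
    [Tr] is computed from that presentation. *)
Definition prd (X : modfl L^c) : modfl L^c := pres1 (pres (syz pres X e)).
Definition difd (X : modfl L^c) : {linear prd X -> pr pres X e} :=
  pres_dif (pres (syz pres X e)).
Definition prd_map (X Y : modfl L^c) (u : {linear X -> Y}) :
  {linear prd X -> prd Y} := Defs.lift1 pres (syz_map pres u e).

Lemma prd_projective X : projective_mod (prd X).
Proof. exact: pres1_projective. Qed.

Lemma prd_dual_basis X : has_dual_basis (prd X).
Proof. by apply: projective_dual_basis; [apply: prd_projective | apply: modflP]. Qed.

Lemma pr_dual_basis X i : has_dual_basis (pr pres X i).
Proof. by apply: projective_dual_basis; [apply: pr_projective | apply: modflP]. Qed.

Lemma aug_difd X p : aug pres X e p = 0 <-> exists q, difd X q = p.
Proof. exact: pres_exact. Qed.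

Lemma difd_map X Y (u : {linear X -> Y}) p :
  difd Y (prd_map u p) = pr_map pres u e (difd X p).
Proof. exact: Defs.lift1E. Qed.

(** Relates a map X -> N to the component P_d -> L of every lift of it. *)
Definition full_stair (D : dexact C e.+1) (X : modfl L^c)
    (g : {linear X -> D e.+2}) (phi : {linear prd X -> D 0}) : Prop :=
  exists f : {linear pr pres X e -> D 1%N}, stair g f /\
    forall p, dx_dif D 0 (phi p) = f (difd X p).

Lemma full_stair_map (D E : dexact C e.+1) (X Y : modfl L^c) (c : chain_map D E)
    (u : {linear X -> Y}) (g : {linear Y -> D e.+2}) (phi : {linear prd Y -> D 0}) :
  full_stair g phi ->
  full_stair (lcomp (c e.+2) (lcomp g u)) (lcomp (c 0) (lcomp phi (prd_map u))).
Proof.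
case=> f [sf fE]; exists (lcomp (c 1%N) (lcomp f (pr_map pres u e))).
split=> [|p]; first exact: stair_map.
by rewrite /= -cm_comm fE difd_map.
Qed.

Section Fixed.
Variables (D : dexact C e.+1) (X : modfl L^c).
Local Notation x := (dx_dif D).

Lemma full_stair_linear (r : R) (g1 g2 : homM X (D e.+2))
    (f1 f2 : homM (prd X) (D 0)) :
  full_stair g1 f1 -> full_stair g2 f2 ->
  full_stair (r *: g1 + g2 : homM X (D e.+2)) (r *: f1 + f2 : homM (prd X) (D 0)).
Proof.
move=> [h1 [s1 e1]] [h2 [s2 e2]].
exists (r *: (h1 : homM _ _) + (h2 : homM _ _) : homM (pr pres X e) (D 1)).
split; first exact: stair_linear.
by move=> p; rewrite !homMD !homME linearD lmapZ e1 e2.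
Qed.

Hypothesis CX : C X.
Hypothesis surjD : lsurjective (x e.+1).

Lemma full_stair_total g : exists phi, @full_stair D X g phi.
Proof.
have [|f sf] := @stair_total R L pres e C ctC D X surjD g e 1; first by rewrite addn1.
have Cp : C (prd X) by apply: (ct_projective ctC); apply: prd_projective.
have [|phi phiE] := dx_contra_exact (d := e.+1) Cp (i := 0) isT (g := lcomp f (difd X)).
  by move=> p; apply: (stair_cycle sf); apply/aug_difd; exists p.
by exists phi, f.
Qed.

(** The class of [g] in delta^*(X) vanishes exactly when that of [phi] vanishes in E(L): full stairs
    embed delta^*(X) in E(L). *)
Lemma full_stair_factor (g : {linear X -> D e.+2}) phi : full_stair g phi ->
  (exists k : {linear X -> D e.+1}, forall y, x e.+1 (k y) = g y) <->
  (exists h : {linear pr pres X e -> D 0}, forall p, phi p = h (difd X p)).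
Proof.
case=> f [sf fE]; apply: (iff_trans (stair_factor ctC CX sf)).
split=> -[h hE]; exists h => p.
  have Cp : C (prd X) by apply: (ct_projective ctC); apply: prd_projective.
  apply/eqP; rewrite -subr_eq0; apply/eqP.
  apply: (dx_contra_mono Cp (g := phi \- lcomp h (difd X))) => {}p.
  by rewrite /= linearB fE hE ?subrr //; apply/aug_difd; exists p.
by move=> /aug_difd[q <-]; rewrite -fE hE.
Qed.

(** The image of this embedding contains the kernel of E(L) -> E(M^1). *)
Lemma full_stair_onto (phi : {linear prd X -> D 0}) (f : {linear pr pres X e -> D 1}) :
  (forall p, x 0 (phi p) = f (difd X p)) -> exists g, @full_stair D X g phi.
Proof.
move=> fE; have [||g sg] := @stair_onto R L pres e C ctC D X CX e 0 f.
- by rewrite addn1.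
- by move=> p /aug_difd[q <-]; rewrite -fE dx_complex.
by exists g, f.
Qed.

End Fixed.
End Relation.

(** * The duality *)

Section Duality.
Variables (R : comNzRingType) (L : algType R).
Variables (pres : forall X : modfl L^c, presentation X).
Variables (e : nat) (C : modfl L^c -> Prop).
Hypothesis ctC : cluster_tilting e.+1 C.
Variable I : lmodType R.
Implicit Types (X Y : modfl L^c) (M N : lmodType L^c).

Definition trM X : lmodType L := transpose pres (syz pres X e).
Definition tr_pi X : {linear starM (prd pres e X) -> trM X} :=
  cokpi (star_map (difd pres e X)).
Definition tauM X : lmodType L^c := tau I pres e.+1 X.
Definition tauM_map X Y (u : {linear X -> Y}) : {linear tauM X -> tauM Y} :=
  fmor (tau I pres e.+1) (u : @Mor (pstab_mod L^c) X Y).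

(* [tau_in] and [tau_out] are identities: they keep the comparison of [tauM X]
   with its unfolding out of the types of linear maps, where it is costly. *)
Definition tau_in X : {linear tauM X -> dualLM I (trM X)} := lid _.
Definition tau_out X : {linear dualLM I (trM X) -> tauM X} := lid _.

Lemma tau_inK X t : tau_out X (tau_in X t) = t.
Proof. by []. Qed.

Lemma tau_outK X t : tau_in X (tau_out X t) = t.
Proof. by []. Qed.

Lemma tau_in_map X Y (u : {linear X -> Y}) (t : tauM X) :
  tau_in Y (tauM_map u t)
  = dualL_map I (transpose_map pres (syz_map pres u e)) (tau_in X t).
Proof. by []. Qed.

Lemma tr_pi_surj X : lsurjective (tr_pi X).
Proof. exact: cokpi_surj. Qed.

Lemma tr_pi_eq0 X xi : tr_pi X xi = 0 <-> exists xi', star_map (difd pres e X) xi' = xi.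
Proof. exact: cokpi_eq0. Qed.

(** The isomorphism Hom(M, tau_d X) = D E(M) as a relation, with functionals on E(M) viewed as
    functionals on Hom(P_d, M) that kill the maps factoring through [difd]. The lemmas that follow
    make it bijective and natural in M. *)
Definition represents X (M : lmodType L^c) (g : {linear M -> tauM X})
    (mu : {linear homM (prd pres e X) M -> I}) : Prop :=
  forall y xi, mu (rank1 y xi)
    = (tau_in X (g y) : {linear res (trM X) -> I}) (tr_pi X xi).

Lemma represents_exists X M (g : {linear M -> tauM X}) :
  exists mu, represents g mu.
Proof.
exact: (functional_of_linear_to_dual (tr_pi X) (@prd_dual_basis _ _ pres e X)
  (lcomp (tau_in X) g)).
Qed.

Lemma represents_onto X M (mu : {linear homM (prd pres e X) M -> I}) :
    (forall h : homM (pr pres X e) M, mu (homM_map (difd pres e X) (lid M) h) = 0) ->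
  exists g, represents g mu.
Proof.
move=> mu0; have [|y xi /tr_pi_eq0[xi' <-]|g gE] :=
    @linear_to_dual_of_functional _ _ I _ _ (tr_pi X) M mu.
- exact: tr_pi_surj.
- by rewrite -(mu0 (rank1 y xi')) rank1_comp.
by exists (lcomp (tau_out X) g) => y xi; rewrite [tau_in X _]tau_outK gE.
Qed.

Lemma represents_dif X M (g : {linear M -> tauM X}) mu : represents g mu ->
  forall h : homM (pr pres X e) M, mu (homM_map (difd pres e X) (lid M) h) = 0.
Proof.
move=> gmu h; have [s ->] := rank1_span (@pr_dual_basis _ _ pres X e) h.
rewrite !lmap_sum big1 // => t _; rewrite rank1_comp gmu.
by rewrite (_ : tr_pi X _ = 0) ?linear0 //; apply/tr_pi_eq0; exists t.2.
Qed.

Lemma represents_eq X M (g : {linear M -> tauM X}) mu mu' :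
  represents g mu -> represents g mu' -> forall phi, mu phi = mu' phi.
Proof.
move=> gmu gmu' phi; have [s ->] := rank1_span (@prd_dual_basis _ _ pres e X) phi.
by rewrite !lmap_sum; apply: eq_bigr => t _; rewrite gmu gmu'.
Qed.

Lemma represents_inj X M (g g' : {linear M -> tauM X}) mu :
  represents g mu -> represents g' mu -> forall y, g y = g' y.
Proof.
move=> gmu gmu' y; rewrite -(tau_inK (g y)) -(tau_inK (g' y)); congr (tau_out X _).
apply: homP => t; have [xi <-] := tr_pi_surj t.
by rewrite -gmu -gmu'.
Qed.

Lemma represents_comp X M N (v : {linear M -> N}) (g : {linear N -> tauM X}) mu :
  represents g mu -> represents (lcomp g v) (lcomp mu (homM_map (lid _) v)).
Proof.
move=> gmu y xi; rewrite /= -gmu rank1_comp; congr (mu (rank1 _ _)).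
by apply: homP.
Qed.

Section Fixed.
Variables (D : dexact C e.+1) (X : modfl L^c).
Local Notation x := (dx_dif D).
Hypothesis CX : C X.
Hypothesis surjD : lsurjective (x e.+1).
Hypothesis injI : injective_mod I.

Definition cdefM : lmodType R := contra_defect D X.
Definition cdef_pi : {linear homM X (D e.+2) -> cdefM} :=
  cokpi (homM_map (lid X) (x e.+1)).
Definition codefM : lmodType R := co_defect D (tauM X).
Definition codef_pi : {linear homM (D 0) (tauM X) -> codefM} :=
  cokpi (homM_map (x 0) (lid (tauM X))).

Lemma cdef_pi_eq0 f : cdef_pi f = 0 <->
  exists k : {linear X -> D e.+1}, forall y, x e.+1 (k y) = (f : {linear _ -> _}) y.
Proof.
split=> [/cokpi_eq0[k kE]|[k kE]]; first by exists k => y; apply: (homM_apply kE y).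
by apply/cokpi_eq0; exists (k : homM _ _); apply: homP => y; apply: kE.
Qed.

(** Says that [mu], as a functional on E(L), restricts to [lam] on the submodule delta^*(X). *)
Definition corresponds (mu : {linear homM (prd pres e X) (D 0) -> I})
    (lam : dualM I cdefM) : Prop :=
  forall (f : {linear X -> D e.+2}) phi, full_stair f phi ->
    mu phi = (lam : {linear cdefM -> I}) (cdef_pi f).

(** The graph of the isomorphism: extend [lam] to E(L), turn the extension into a map L -> tau_d X,
    and take its class. *)
Definition duality (lam : dualM I cdefM) (q : codefM) : Prop :=
  exists (g : {linear D 0 -> tauM X}) mu,
    [/\ codef_pi g = q, represents g mu & corresponds mu lam].

Lemma duality_linear a lam lam' q q' : duality lam q -> duality lam' q' ->
  duality (a *: lam + lam') (a *: q + q').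
Proof.
move=> [g [mu [<- gmu cmu]]] [g' [mu' [<- gmu' cmu']]].
pose ag : {linear D 0 -> tauM X} := a *: (g : homM (D 0) (tauM X)) + (g' : homM (D 0) (tauM X)).
have [nu nuE] : exists nu : {linear homM (prd pres e X) (D 0) -> I},
    forall phi, nu phi = a *: mu phi + mu' phi.
  apply: linear_fun => r f f'.
  rewrite (linearP mu r f f') (linearP mu' r f f') !scalerDr !scalerA.
  by rewrite addrACA [a * r]mulrC.
exists ag, nu; split=> [|y xi|f phi s]; first exact: linearP.
  have tE : tau_in X (ag y) = (a%:A : L^c) *: tau_in X (g y) + tau_in X (g' y).
    exact: (linearP (tau_in X)).
  rewrite nuE gmu gmu' tE dualLM_add dualLM_scale.
  have := dualLM_linear (tau_in X (g y)) a (tr_pi X xi) 0.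
  by rewrite linear0 addr0 addr0 => ->.
by rewrite nuE (cmu _ _ s) (cmu' _ _ s).
Qed.

(** Such a composite ends a full stair, with [h] followed by L -> M^1 as the lift before it; the map
    X -> N at its top factors through M^d -> N and has class zero. *)
Lemma corresponds_dif mu lam : corresponds mu lam ->
  forall h : {linear pr pres X e -> D 0}, mu (lcomp h (difd pres e X)) = 0.
Proof.
move=> cmu h.
have [|g sg] := @full_stair_onto _ _ pres e C ctC D X CX (lcomp h (difd pres e X)) (lcomp (x 0) h).
  by [].
rewrite (cmu _ _ sg) (_ : cdef_pi _ = 0) ?linear0 //; apply/cdef_pi_eq0.
by apply/(full_stair_factor ctC CX sg); exists h.
Qed.

Lemma duality_total lam : exists q, duality lam q.
Proof.
pose K : {pred homM (prd pres e X) (D 0)} := fun phi =>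
  `[< exists f : {linear X -> D e.+2}, full_stair f phi >].
have s0 : full_stair (0 : homM X (D e.+2)) (0 : homM (prd pres e X) (D 0)).
  by exists \0; split=> [|p]; [apply: stair_zero; rewrite addn1 | rewrite linear0].
have KC : GRing.submod_closed K.
  split; first by apply/asboolP; exists (0 : homM X (D e.+2)).
  move=> a u v /asboolP[f sf] /asboolP[g sg]; apply/asboolP.
  by exists (a *: (f : homM _ _) + (g : homM _ _) : homM _ _); apply: full_stair_linear.
(* Makes [lam] well defined on [K]: a map with zero lift has class zero. *)
have cdefE (f : {linear X -> D e.+2}) (phi : {linear prd pres e X -> D 0}) :
    full_stair f phi -> phi = 0 :> homM _ _ -> cdef_pi f = 0.
  move=> sf phi0; apply/cdef_pi_eq0/(full_stair_factor ctC CX sf).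
  by exists \0 => p; apply: (homM_apply phi0 p).
have [u|a u u' z z' [f [sf ->]] [f' [sf' ->]]|z [f [sf ->]]|mu0 mu0E] :=
  @linear_relation _ (submM KC) I (fun u z => exists f : homM X (D e.+2),
    full_stair (f : {linear _ -> _}) (submodule_incl KC u : {linear _ -> _}) /\
    z = (lam : {linear cdefM -> I}) (cdef_pi f)).
- have /asboolP[f sf] : submodule_incl KC u \in K by apply/(submodule_inclP KC); exists u.
  by exists ((lam : {linear cdefM -> I}) (cdef_pi f)), f.
- exists (a *: f + f'); split; last by rewrite !linearP.
  by rewrite linearP; apply: full_stair_linear.
- by rewrite (cdefE _ _ sf) ?linear0.
(* Any extension from [K] to Hom(P_d, L) will do: [duality0l] shows that the class [q] does not
   depend on it. *)
have [mu muE] := injI mu0 (@submodule_incl_inj _ _ _ KC).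
have cmu : corresponds mu lam.
  move=> f phi sf.
  have /(submodule_inclP KC)[u uE] : phi \in K by apply/asboolP; exists f.
  rewrite -uE muE; have [f' [sf' ->]] := mu0E u; rewrite uE in sf'.
  apply/eqP; rewrite -subr_eq0 -linearB; apply/eqP.
  rewrite (_ : _ - _ = 0) ?linear0 //.
  rewrite -linearB -[_ - _](addrC) -scaleN1r.
  apply: cdefE (full_stair_linear (-1) sf sf') _.
  by rewrite scaleN1r addNr.
have [|g gmu] := @represents_onto X _ mu.
  by move=> h; rewrite -(corresponds_dif cmu h); congr (mu _); apply: homP.
by exists (codef_pi g), g, mu.
Qed.

(** [lam] evaluates [mu] on lifts. Ambiguity disappears because the lifts of maps factoring through
    M^d -> N factor through [difd], where [mu] vanishes. *)
Lemma duality_onto q : exists lam, duality lam q.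
Proof.
have [g <-] := cokpi_surj q; have [mu gmu] := represents_exists g.
have muF f phi : full_stair f phi ->
    (exists k : {linear X -> D e.+1}, forall y, x e.+1 (k y) = f y) -> mu phi = 0.
  move=> sf /(full_stair_factor ctC CX sf)[h hE].
  by rewrite -(represents_dif gmu h); congr (mu _); apply: homP.
have [f|a f f' z z' [p [sp ->]] [p' [sp' ->]]|z [p [sp ->]]|l lE] :=
  @linear_relation _ (homM X (D e.+2)) I (fun f z => exists phi : homM (prd pres e X) (D 0),
    full_stair (f : {linear _ -> _}) (phi : {linear _ -> _}) /\ z = mu phi).
- have [phi sphi] := full_stair_total pres ctC surjD f.
  by exists (mu phi), phi.
- by exists (a *: p + p'); split; [apply: full_stair_linear | rewrite linearP].
- by apply: muF sp _; exists \0 => y; rewrite linear0.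
have [k|lam lamE] := @desc_coker _ _ _ _ (homM_map (lid X) (x e.+1)) l.
  by have [p [sp ->]] := lE (homM_map (lid X) (x e.+1) k); apply: muF sp _; exists k.
exists lam, g, mu; split=> // f phi sf.
apply: etrans (esym (lamE f)); have [p [sp ->]] := lE f.
apply/eqP; rewrite -subr_eq0 -linearB addrC -scaleN1r; apply/eqP.
apply: muF (full_stair_linear (-1) sp sf) _; exists \0 => y.
by rewrite linear0 scaleN1r addNr.
Qed.

(** If [lam] is 0, [mu] kills the kernel of Hom(P_d, L) -> E(M^1). As I is injective, it extends to
    E(M^1), giving a map M^1 -> tau_d X through which [g] factors. *)
Lemma duality0l q : duality 0 q -> q = 0.
Proof.
move=> [g [mu [<- gmu cmu]]].
pose E := cokM (homM_map (difd pres e X) (lid (D 1))).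
pose E_pi := cokpi (homM_map (difd pres e X) (lid (D 1))).
have [phi|nu nuE] := @ext_injective _ _ _ _
  (lcomp E_pi (homM_map (lid (prd pres e X)) (x 0))) mu injI.
  move=> /cokpi_eq0[f fE].
  have [p|k sk] := @full_stair_onto _ _ pres e C ctC D X CX phi f.
    exact: (esym (homM_apply fE p)).
  by rewrite (cmu _ _ sk).
have [h|g1 g1E] := @represents_onto X (D 1) (lcomp nu E_pi).
  by rewrite /= (_ : E_pi _ = 0) ?linear0 //; apply/cokpi_eq0; exists h.
apply/cokpi_eq0; exists (g1 : homM _ _); apply: homP => y.
have r1 : represents (lcomp g1 (x 0)) mu.
  by move=> z xi; rewrite -nuE -(represents_comp (x 0) g1E).
exact: (represents_inj r1 gmu y).
Qed.

Lemma duality0r lam : duality lam 0 -> lam = 0.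
Proof.
move=> [g [mu [/cokpi_eq0[g1 g1E] gmu cmu]]].
apply: homP => z; have [f <-] := cokpi_surj z.
have [phi sphi] := full_stair_total pres ctC surjD f.
rewrite -[LHS](cmu f phi sphi).
have [mu1 gmu1] := represents_exists (g1 : {linear _ -> _}).
have gmu' : represents g (lcomp mu1 (homM_map (lid _) (x 0))).
  move=> y xi; rewrite (represents_comp (x 0) gmu1).
  by rewrite -(homM_apply g1E y).
(* The composite of [phi] with L -> M^1 factors through [difd], and [mu1] kills such maps. *)
have [f' [_ f'E]] := sphi.
rewrite (represents_eq gmu gmu') -[RHS](represents_dif gmu1 f') /=.
by congr (mu1 _); apply: homP => p; apply: f'E.
Qed.

Lemma duality_iso : exists (f : {linear dualM I cdefM -> codefM})
    (g : {linear codefM -> dualM I cdefM}),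
  [/\ forall lam, g (f lam) = lam, forall q, f (g q) = q
    & forall lam q, duality lam q <-> f lam = q].
Proof.
have [lam|a lam lam' q q'|q|f fE] := @linear_relation _ _ _ duality.
- exact: duality_total.
- exact: duality_linear.
- exact: duality0l.
have fP lam q : duality lam q <-> f lam = q.
  split=> [dq|<-]; last exact: fE.
  apply/esym/eqP; rewrite -subr_eq0 addrC -scaleN1r; apply/eqP/duality0l.
  have l0 : -1 *: lam + lam = 0 by rewrite scaleN1r addNr.
  by have := duality_linear (-1) (fE lam) dq; rewrite l0.
have fS : lsurjective f by move=> q; have [lam /fP] := duality_onto q; exists lam.
have [lam|g gE] := desc_surjective (g := lid _) fS.
  by move=> /fP/duality0r.
exists f, g; split=> // q; have [lam <-] := fS q; by rewrite gE.
Qed.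

End Fixed.

(** The witnesses for the image pair are the given ones composed with [c], [prd_map] and
    [tauM_map]. *)
Lemma duality_map (D E : dexact C e.+1) X Y (c : chain_map E D) (u : {linear X -> Y})
    (lam : dualM I (cdefM D X)) (q : codefM D X) :
  duality lam q ->
  duality (dualR_map I (contra_defect_map c u) lam : dualM I (cdefM E Y))
    (co_defect_map c (tauM_map u) q : codefM E Y).
Proof.
move=> [g [mu [<- gmu cmu]]].
exists (lcomp (tauM_map u) (lcomp g (c 0))), (lcomp mu (homM_map (prd_map pres e u) (c 0))).
split.
- exact: esym (coker_map_funE (co_defect_map_subproof c (tauM_map u)) g).
- move=> y xi.
  apply: (@etrans _ _ (mu (homM_map (prd_map pres e u) (c 0) (rank1 y xi)))); first by [].
  rewrite rank1_comp gmu; apply: esym.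
  apply: etrans (congr1 (fun f : dualLM I (trM Y) => (f : {linear res (trM Y) -> I})
    (tr_pi Y xi)) (tau_in_map u (g (c 0 y)))) _.
  congr ((tau_in X (g (c 0 y)) : {linear res (trM X) -> I}) _); apply: esym.
  exact: esym (coker_map_funE (transpose_map_subproof (syz_map pres u e)) xi).
move=> f phi sf; apply: etrans (cmu _ _ (full_stair_map c u sf)) _.
congr ((lam : {linear cdefM D X -> I}) _).
exact: esym (coker_map_funE (contra_defect_map_subproof c u) (f : homR _ _)).
Qed.

Lemma duality_natural :
    (forall D : dexact C e.+1, lsurjective (dx_dif D e.+1)) -> injective_mod I ->
  exists eta : forall (D : dexact C e.+1) X, C X -> {linear dualM I (cdefM D X) -> codefM D X},
    (forall D X (CX : C X), exists g : {linear codefM D X -> dualM I (cdefM D X)},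
       (forall lam, g (eta D X CX lam) = lam) /\ (forall q, eta D X CX (g q) = q)) /\
    (forall (D E : dexact C e.+1) X Y (CX : C X) (CY : C Y) (c : chain_map E D)
       (u : {linear X -> Y}) (lam : dualM I (cdefM D X)),
       eta E Y CY (dualR_map I (contra_defect_map c u) lam : dualM I (cdefM E Y))
       = (co_defect_map c (tauM_map u) (eta D X CX lam) : codefM E Y)).
Proof.
move=> surjC injI.
pose iso D X (CX : C X) := cid (duality_iso CX (surjC D) injI).
exists (fun D X CX => sval (iso D X CX)); split=> [D X CX|D E X Y CX CY c u lam].
  by have [g [gE fE _]] := svalP (iso D X CX); exists g.
have [_ [_ _ etaX]] := svalP (iso D X CX).
have [_ [_ _ etaY]] := svalP (iso E Y CY).
by apply/etaY; apply: duality_map; apply/etaX.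
Qed.

End Duality.

(** * Functoriality *)

Section Functoriality.

(** Each component is surjective, so every law for [G] can be tested on images of elements of
    [F]. *)
Lemma transport_functor_to_mod (R : pzRingType) (K : category)
    (F G : fdata K (Mod R)) (eta : forall X, @Mor (Mod R) (F X) (G X)) :
    (forall X, @is_iso (Mod R) _ _ (eta X)) ->
    (forall X Y (f : Mor X Y),
       @meq (Mod R) _ _ (@Defs.comp (Mod R) _ _ _ (eta Y) (fmor F f))
                        (@Defs.comp (Mod R) _ _ _ (fmor G f) (eta X))) ->
  functor_to_mod F -> functor_to_mod G.
Proof.
move=> iso nat [[Fmeq Fid Fcomp] Ffl].
have surj X (z : G X) : exists y, eta X y = z.
  by have [t [_ tE]] := iso X; exists (t z); apply: tE.
split; first split.
- move=> X Y f g fg z; have [y <-] := surj _ z.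
  exact: etrans (esym (nat X Y f y))
    (etrans (congr1 (eta Y) (Fmeq _ _ _ _ fg y)) (nat X Y g y)).
- move=> X z; have [y <-] := surj _ z.
  exact: etrans (esym (nat X X (idm X) y)) (congr1 (eta X) (Fid X y)).
- move=> X Y Z g f z; have [y <-] := surj _ z.
  apply: etrans (esym (nat X Z (Defs.comp g f) y)) _.
  apply: etrans (congr1 (eta Z) (Fcomp _ _ _ g f y)) _.
  exact: etrans (nat Y Z g _) (congr1 (fmor G g) (nat X Y f y)).
- by move=> X; apply: (quotient_finite_length (p := eta X)); first exact: surj.
Qed.

Lemma linear_is_iso (R : pzRingType) (M N : lmodType R) (f : {linear M -> N})
    (g : {linear N -> M}) :
  (forall x, g (f x) = x) -> (forall y, f (g y) = y) -> @is_iso (Mod R) M N f.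
Proof. by move=> gK fK; exists g. Qed.

Variables (R : comNzRingType) (L : algType R).
Hypothesis artinL : artin_algebra L.
Variables (I : lmodType R) (d : nat) (C : modfl L^c -> Prop).
Hypothesis envI : envelope_of_simples I.
Hypothesis surjC : forall D : dexact C d, lsurjective (dx_dif D d).

Lemma contra_defect_mapE (D E : dexact C d) (X Y : lmodType L^c)
    (c : chain_map D E) (u : {linear X -> Y}) (g : homM Y (D d.+1)) :
  contra_defect_map c u (cokpi (homM_map (lid Y) (dx_dif D d)) g)
  = cokpi (homM_map (lid X) (dx_dif E d)) (homM_map u (c d.+1) g).
Proof. exact: (coker_map_funE (contra_defect_map_subproof c u)). Qed.

Lemma contra_defect_map_id (D : dexact C d) (X : lmodType L^c) z :
  contra_defect_map (chain_id D) (lid X) z = z.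
Proof.
have [g <-] := cokpi_surj z; rewrite contra_defect_mapE; congr (cokpi _ _).
by apply: homP.
Qed.

Lemma contra_defect_map_comp (D E F : dexact C d) (X Y Z : lmodType L^c)
    (c : chain_map E F) (c' : chain_map D E) (u : {linear Y -> Z})
    (u' : {linear X -> Y}) z :
  contra_defect_map (chain_comp c c') (lcomp u u') z
  = contra_defect_map c u' (contra_defect_map c' u z).
Proof.
have [g <-] := cokpi_surj z; rewrite (contra_defect_mapE c' u g) !contra_defect_mapE.
by congr (cokpi _ _); apply: homP.
Qed.

(** Both changes alter a map X -> N by one that lifts to the term before N: a homotopy supplies the
    lift, and maps from the projective W lift by surjectivity of the last differential. *)
Lemma contra_defect_map_meq (D E : dexact C d) (X Y : modfl L^c)
    (c c' : chain_map D E) (u u' : {linear X -> Y}) :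
    homotopic c c' -> stable_eq (@projective_fl L^c) u u' ->
  forall z, contra_defect_map c u z = contra_defect_map c' u' z.
Proof.
move=> [h [_ hS]] [W [a [b [[_ pW] uE]]]] z.
have [g <-] := cokpi_surj z; rewrite !contra_defect_mapE; apply/cpiP.
have [k kE] := pW _ _ (dx_dif E d)
  (lcomp (c' d.+1) (lcomp (g : {linear _ -> _}) b)) (surjC (D := E)).
exists ((lcomp (h d) (lcomp (g : {linear _ -> _}) u) : homR X (E d)) + (lcomp k a : homR X (E d))).
apply: homP => x /=; rewrite linearD kE.
(* In the last degree the second term of the homotopy formula passes through [D d.+2], which is
   zero. *)
set y := g _; have := hS d y; rewrite (dx_zero (ltnSn _) (dx_dif D d.+1 y)) linear0 addr0 => <-.
by rewrite /= -uE !linearB addrA subrK.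
Qed.

Lemma dualR_map_ext (V W : lmodType R) (f f' : {linear V -> W}) :
  (forall z, f z = f' z) -> forall l, dualR_map I f l = dualR_map I f' l.
Proof. by move=> ff' l; apply: homP => z; rewrite /= ff'. Qed.

Lemma dualR_map_id (V : lmodType R) (f : {linear V -> V}) :
  (forall z, f z = z) -> forall l, dualR_map I f l = l.
Proof. by move=> f1 l; apply: homP => z; rewrite /= f1. Qed.

Lemma dualR_map_comp (V W U : lmodType R) (h : {linear V -> U})
    (g : {linear W -> U}) (f : {linear V -> W}) :
  (forall z, h z = g (f z)) ->
  forall l, dualR_map I h l = lcomp (dualR_map I f) (dualR_map I g) l.
Proof. by move=> hE l; apply: homP => z; rewrite /= hE. Qed.

Local Notation obj := (prodC (op (KdEx C d)) (pstab_sub C)).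
Local Notation F := (@dual_contra_defect R L I C d).

Lemma dual_contra_defect_comp (D E G : dexact C d) (X Y Z : modfl L^c)
    (CX : C X) (CY : C Y) (CZ : C Z) (c : chain_map G E) (c' : chain_map E D)
    (u : {linear Y -> Z}) (u' : {linear X -> Y}) :
  @meq (Mod R) _ _
    (fmor F (@Defs.comp obj (D, exist _ X CX) (E, exist _ Y CY) (G, exist _ Z CZ)
               (c, u) (c', u')))
    (@Defs.comp (Mod R) _ _ _
       (@fmor _ _ F (E, exist _ Y CY) (G, exist _ Z CZ) (c, u))
       (@fmor _ _ F (D, exist _ X CX) (E, exist _ Y CY) (c', u'))).
Proof.
move=> l.
change (dualR_map I (contra_defect_map (chain_comp c' c) (lcomp u u')) l =
  lcomp (dualR_map I (contra_defect_map c u)) (dualR_map I (contra_defect_map c' u')) l).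
by apply: dualR_map_comp; apply: contra_defect_map_comp.
Qed.

Lemma dual_contra_defect_functor : functor_to_mod F.
Proof.
split; first split.
- move=> [D [X CX]] [E [Y CY]] [c u] [c' u'] [cc' uu'] l.
  change (dualR_map I (contra_defect_map c u) l = dualR_map I (contra_defect_map c' u') l).
  exact: dualR_map_ext (contra_defect_map_meq cc' uu') l.
- move=> [D [X CX]] l.
  change (dualR_map I (contra_defect_map (chain_id D) (lid X)) l = l).
  by apply: dualR_map_id; apply: contra_defect_map_id.
- move=> [D [X CX]] [E [Y CY]] [G [Z CZ]] [c u] [c' u'].
  exact: dual_contra_defect_comp.
move=> [D [X CX]]; apply: dual_finite_length => //=.
apply: (quotient_finite_length (p := cokpi _)); first exact: cokpi_surj.
by apply: hom_finite_length => //; apply: modflP.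
Qed.

End Functoriality.

Theorem theorem3p8 (R : comNzRingType) (L : algType R)
    (artinL : artin_algebra L)
    (I : lmodType R) (envI : envelope_of_simples I)
    (pres : forall X : modfl L^c, presentation X)
    (d : nat) (d_ge1 : (1 <= d)%N)
    (C : modfl L^c -> Prop) (ctC : cluster_tilting d C) :
  [/\ functor_to_mod (@dual_contra_defect R L I C d),
      functor_to_mod (@co_defect_tau R L I C d pres)
    & naturally_isomorphic (@dual_contra_defect R L I C d)
                           (@co_defect_tau R L I C d pres)].
Proof.
have surjC (D : dexact C d) : lsurjective (dx_dif D d).
  exact (dexact_surjective artinL envI pres ctC (D := D)).
have injI := envelope_injective envI.
have Ffun := dual_contra_defect_functor artinL envI surjC.
suff [eta [iso nat]] : naturally_isomorphic (@dual_contra_defect R L I C d)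
                           (@co_defect_tau R L I C d pres).
  by split=> //; [apply: transport_functor_to_mod iso nat Ffun | exists eta].
(* With d = e + 1 the number [d.-1] of syzygies in tau_d computes to e. *)
case: d d_ge1 ctC surjC {Ffun} => [//|e] _ {}ctC surjC.
have [eta [etaK nat]] := duality_natural pres ctC surjC injI.
exists (fun p => eta p.1 (sval p.2) (svalP p.2)); split=> [p|p q f].
  have [g [gE fE]] := etaK p.1 (sval p.2) (svalP p.2).
  exact (linear_is_iso gE fE).
have natf : @meq (Mod R) (dualM I (cdefM p.1 (sval p.2))) (codefM pres I q.1 (sval q.2))
    (@Defs.comp (Mod R) _ (dualM I (cdefM q.1 (sval q.2))) _ (eta q.1 (sval q.2) (svalP q.2))
       (dualR_map I (contra_defect_map f.1 f.2)))
    (@Defs.comp (Mod R) _ (codefM pres I p.1 (sval p.2)) _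
       (co_defect_map f.1 (tauM_map pres e I f.2)) (eta p.1 (sval p.2) (svalP p.2))).
  exact (nat p.1 q.1 (sval p.2) (sval q.2) (svalP p.2) (svalP q.2) f.1 f.2).
exact natf.
Qed.
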